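(* For any $\mu\in\Delta^+_l$, we have $I(\mu)_{\max}\subset I\langle\succcurlyeq\mu\rangle$, where $I\langle\succcurlyeq\mu\rangle=\{\nu\in\Delta^+\mid\nu\succcurlyeq\mu\}$. In particular, if $I\in\mathfrak{Ab}_\mu$, then $I\subset I\langle\succcurlyeq\mu\rangle$.
   Context: Let $\mathfrak g$ be a complex simple Lie algebra with triangular decomposition $\mathfrak g=\mathfrak u\oplus\mathfrak t\oplus\mathfrak u^-$, Borel subalgebra $\mathfrak b=\mathfrak u\oplus\mathfrak t$, root system $\Delta$ of $(\mathfrak g,\mathfrak t)$, positive roots $\Delta^+$ (corresponding to $\mathfrak u$), simple roots $\Pi=\{\alpha_1,\dots,\alpha_n\}$, highest root $\theta$, Weyl group $W$, and $W$-invariant inner product $(\ ,\ )$ on $V=\bigoplus_i\mathbb R\alpha_i$. $\Delta^+_l$ is the set of long positive roots (all roots are long in the simply-laced case). Root order on $\Delta^+$: $\mu\preccurlyeq\nu$ iff $\nu-\mu$ is a non-negative integral combination of simple roots. Abelian ideals: $\mathfrak{Ab}$ is the poset (under inclusion) of subspaces $\mathfrak a\subset\mathfrak u$ with $[\mathfrak b,\mathfrak a]\subset\mathfrak a$ and $[\mathfrak a,\mathfrak a]=0$. Each is a sum of root spaces and is identified with the corresponding set $I\subset\Delta^+$, which is an upper ideal of $(\Delta^+,\preccurlyeq)$ with no two elements summing to a root. Minuscule elements: let $\widehat V=V\oplus\mathbb R\delta\oplus\mathbb R\lambda$ with $(\delta,V)=(\lambda,V)=(\delta,\delta)=(\lambda,\lambda)=0$,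 $(\delta,\lambda)=1$; $\alpha_0=\delta-\theta$; $\mu^\vee=2\mu/(\mu,\mu)$; $s_i(x)=x-(x,\alpha_i)\alpha_i^\vee$ for $0\le i\le n$; $\widehat W=\langle s_0,\dots,s_n\rangle\subset GL(\widehat V)$; $\widehat\Delta^+=\Delta^+\cup\{\gamma+k\delta\mid\gamma\in\Delta,\ k\ge1\}$; $\mathcal N(w)=\{\nu\in\widehat\Delta^+\mid w(\nu)\in-\widehat\Delta^+\}$. An element $w\in\widehat W$ is minuscule if $\mathcal N(w)=\{\delta-\gamma\mid\gamma\in I_w\}$ for some $I_w\subset\Delta$. Then $I_w$ is an abelian ideal and $w\mapsto I_w$ is a bijection from minuscule elements onto $\mathfrak{Ab}$; write $w_I$ for the element corresponding to $I$. Rootlets: for a nonzero abelian ideal $I$, the rootlet is $\mathrm{rt}(I)=w_I(2\delta-\theta)$, which lies in $\Delta^+_l$. For $\mu\in\Delta^+_l$, $\mathfrak{Ab}_\mu$ is the set of nonzero abelian ideals with rootlet $\mu$. It is known that $\mathfrak{Ab}_\mu$ is nonempty and has a unique minimal element $I(\mu)_{\min}$ and a unique maximal element $I(\mu)_{\max}$. *)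

(* Defs.v *)
From mathcomp Require Import all_boot all_order all_algebra.
From mathcomp Require Import boolp classical_sets reals.
From mathcomp Require Export complex.

Set Implicit Arguments.
Unset Strict Implicit.
Unset Printing Implicit Defensive.

Import Order.TTheory GRing.Theory Num.Theory.
Local Open Scope classical_set_scope.
Local Open Scope ring_scope.

Section LieAlgebra.
Context (K : fieldType) (g : vectType K).
Variable br : g -> g -> g.

Definition lie_bracket : Prop :=
  [/\ forall (c : K) x y z, br (c *: x + y) z = c *: br x z + br y z,
      forall (c : K) x y z, br z (c *: x + y) = c *: br z x + br z y,
      forall x, br x x = 0
    & forall x y z, br x (br y z) + br y (br z x) + br z (br x y) = 0].

Definition lie_ideal (a : {vspace g}) : Prop :=
  forall x y, y \in a -> br x y \in a.

Definition lie_simple : Prop :=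
  (exists x y, br x y <> 0) /\
  (forall a, lie_ideal a -> a = 0%VS \/ a = fullv).

Definition lie_abelian (a : {vspace g}) : Prop :=
  forall x y, x \in a -> y \in a -> br x y = 0.

Definition ad_diagonalizable (h : g) : Prop :=
  exists e : seq g, basis_of fullv e /\
    forall x, x \in e -> exists c : K, br h x = c *: x.

Definition toral (t : {vspace g}) : Prop :=
  lie_abelian t /\ forall h, h \in t -> ad_diagonalizable h.

(* For a semisimple Lie algebra over the complex numbers the Cartan
   subalgebras are the maximal toral subalgebras. *)
Definition cartan_subalgebra (t : {vspace g}) : Prop :=
  toral t /\ forall t' : {vspace g}, toral t' -> (t <= t')%VS -> t' = t.

Definition weight_vector (t : {vspace g})
    (l : 'Hom(subvs_of t, K^o)) (x : g) : Prop :=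
  forall h : subvs_of t, br (vsval h) x = (l h : K) *: x.

Definition lie_root (t : {vspace g}) (l : 'Hom(subvs_of t, K^o)) : Prop :=
  l <> 0 /\ exists x, x <> 0 /\ weight_vector l x.

Definition spanned_by (U : {vspace g}) (P : g -> Prop) : Prop :=
  (forall x, P x -> x \in U) /\
  (forall U' : {vspace g}, (forall x, P x -> x \in U') -> (U <= U')%VS).

End LieAlgebra.

(* All generating sets used below consist of involutions, so closing under
   composition gives the generated group. *)
Inductive generated (T : Type) (S : set (T -> T)) : (T -> T) -> Prop :=
| gen_id : generated S id
| gen_comp s w : S s -> generated S w -> generated S (s \o w).

Definition maximal_in (K : fieldType) (g : vectType K) (A : set {vspace g})
    (a : {vspace g}) : Prop :=
  A a /\ forall b, A b -> (a <= b)%VS -> b = a.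

Definition unique_maximal (K : fieldType) (g : vectType K) (A : set {vspace g})
    (a : {vspace g}) : Prop :=
  maximal_in A a /\ forall b, maximal_in A b -> b = a.

(* The real space V with basis the simple roots is 'rV[R]_n: a vector is the
   row of its coordinates in the basis alpha_0, ..., alpha_(n-1), and [wt]
   maps it to the corresponding linear form on the Cartan subalgebra t. *)
Section Roots.
Context (R : realType) (g : vectType R[i]) (t : {vspace g}) (n : nat).
Variable br : g -> g -> g.
Variable alpha : 'I_n -> 'Hom(subvs_of t, R[i]^o).
Local Notation V := 'rV[R]_n.

Definition wt (x : V) : 'Hom(subvs_of t, R[i]^o) :=
  \sum_(i < n) (x 0 i)%:C%C *: alpha i.

Definition simple_root (i : 'I_n) : V := delta_mx 0 i.

Definition Delta : set V := [set x | lie_root br (wt x)].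

Definition root_le (x y : V) : Prop :=
  forall i, (y - x) 0 i \is a Num.nat.

Definition Delta_pos : set V := [set x | Delta x /\ root_le 0 x].

Definition root_base : Prop :=
  [/\ free [seq alpha i | i <- enum 'I_n],
      forall i, lie_root br (alpha i)
    & forall l, lie_root br l ->
        exists x, l = wt x /\ (root_le 0 x \/ root_le 0 (- x))].

Definition triangular_decomposition (u um : {vspace g}) : Prop :=
  [/\ cartan_subalgebra br t,
      spanned_by u
        (fun e => exists2 x, Delta_pos x & weight_vector br (wt x) e),
      spanned_by um
        (fun e => exists2 x, Delta_pos x & weight_vector br (wt (- x)) e),
      (u + t + um)%VS = fullv
    & directv (u + t + um)].

Definition highest_root (theta : V) : Prop :=
  Delta_pos theta /\ forall x, Delta_pos x -> root_le x theta.

(* The element h of [g_x, g_(-x)] with x(h) = 2.  Root spaces are lines, so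
   every element of [g_x, g_(-x)] is a single bracket. *)
Definition coroot (x : V) (h : subvs_of t) : Prop :=
  wt x h = 2 /\
  exists e f, [/\ weight_vector br (wt x) e, weight_vector br (wt (- x)) f
                & br e f = vsval h].

Definition root_reflection : set (V -> V) :=
  [set s | exists x h, [/\ Delta x, coroot x h
                         & forall y, wt (s y) = wt y - wt y h *: wt x]].

Definition weyl_group : set (V -> V) := generated root_reflection.

Definition inner_product (ip : V -> V -> R) : Prop :=
  [/\ forall c x y z, ip (c *: x + y) z = c * ip x z + ip y z,
      forall x y, ip x y = ip y x
    & forall x, x <> 0 -> 0 < ip x x].

Definition weyl_invariant (ip : V -> V -> R) : Prop :=
  forall w, weyl_group w -> forall x y, ip (w x) (w y) = ip x y.

Definition long_pos (ip : V -> V -> R) : set V :=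
  [set x | Delta_pos x /\ forall y, Delta y -> ip y y <= ip x x].

Definition abelian_ideal (u a : {vspace g}) : Prop :=
  [/\ (a <= u)%VS,
      forall x y, x \in (u + t)%VS -> y \in a -> br x y \in a
    & lie_abelian br a].

Definition ideal_roots (a : {vspace g}) : set V :=
  [set x | Delta_pos x /\ forall e, weight_vector br (wt x) e -> e \in a].

Definition upper_roots (mu : V) : set V :=
  [set nu | Delta_pos nu /\ root_le mu nu].

End Roots.

(* (x, a, b) stands for x + a delta + b lambda. *)
Definition hatV (R : realType) (n : nat) := ('rV[R]_n * R^o * R^o)%type.

Section Affine.
Context (R : realType) (g : vectType R[i]) (t : {vspace g}) (n : nat).
Variable br : g -> g -> g.
Variable alpha : 'I_n -> 'Hom(subvs_of t, R[i]^o).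
Variable ip : 'rV[R]_n -> 'rV[R]_n -> R.
Variable theta : 'rV[R]_n.
Local Notation V := 'rV[R]_n.
Local Notation hV := (hatV R n).

Definition inV (x : V) : hV := (x, 0, 0).
Definition delta : hV := (0, 1, 0).

Definition hat_form (x y : hV) : R :=
  ip x.1.1 y.1.1 + x.1.2 * y.2 + x.2 * y.1.2.

Definition affine_simple_root (i : 'I_n.+1) : hV :=
  if unlift ord0 i is Some j then inV (simple_root R j) else delta - inV theta.

Definition hat_coroot (x : hV) : hV := (2 / hat_form x x) *: x.

Definition affine_reflection (i : 'I_n.+1) (x : hV) : hV :=
  x - hat_form x (affine_simple_root i) *: hat_coroot (affine_simple_root i).

Definition affine_weyl : set (hV -> hV) :=
  generated [set s | exists i, s = affine_reflection i].

Definition hatDelta_pos : set hV :=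
  [set inV x | x in Delta_pos br alpha] `|`
  [set v | exists x k, [/\ Delta br alpha x, (1 <= k)%N
                         & v = inV x + delta *+ k]].

Definition inversions (w : hV -> hV) : set hV :=
  [set v | hatDelta_pos v /\ hatDelta_pos (- w v)].

Definition minuscule (I : set V) (w : hV -> hV) : Prop :=
  [/\ affine_weyl w, I `<=` Delta br alpha
    & inversions w = [set delta - inV x | x in I]].

(* The element w_I; [xget] picks the minuscule element with set I.  If there
   were none, the default [id] would give the rootlet 2 delta - theta, which
   is not in V. *)
Definition minuscule_of (I : set V) : hV -> hV :=
  @xget (hV -> hV) id (minuscule I).

Definition rootlet (I : set V) : hV :=
  minuscule_of I (delta *+ 2 - inV theta).

Definition Ab_rootlet (u : {vspace g}) (mu : V) : set {vspace g} :=
  [set a | [/\ abelian_ideal t br u a, a <> 0%VS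
             & rootlet (ideal_roots br alpha a) = inV mu]].

End Affine.

(* Main.v *)
(** Let w be the minuscule element of I, so that w (2 delta - theta) = mu.  Peeling
    simple reflections off w one at a time adds one root nu to I at each step: if
    w = s_i w_0 and w_0 (delta - nu) = alpha_i, then w x = w_0 x + <x, nu^v> alpha_i
    for x in V.  Comparing <theta, nu^v> with <gamma, nu^v> along this chain gives
    mu <= gamma for all gamma in I that are not orthogonal to theta.

    For gamma in I orthogonal to theta, argue by descending induction.  A failure
    mu_j > gamma_j forces gamma_j = 0, mu_j = 1, gamma + alpha_j in I,
    |gamma| = |alpha_j| and (mu, alpha_j) > 0.  Removing from I its roots orthogonal
    to theta gives u with u theta = w theta.  Then u gamma is a root of Delta which
    climbs, by simple reflections orthogonal to mu (hence without changing the j-th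
    coordinate), to a dominant root tau, and theta <= (|theta|^2 / |tau|^2) tau
    contradicts the bound on (u gamma)_j obtained from the chain of u.

    What this needs about Delta (coroots, integrality, reflections) comes from sl2
    and from the trace form of g: its radical is an ideal which is not g as soon as
    one coroot exists, so it vanishes and every root has a coroot. *)

From HB Require Import structures.
Require Import Defs.
From mathcomp Require Import all_boot all_order all_algebra.
From mathcomp Require Import boolp classical_sets reals.
From mathcomp Require Import zify ring lra.

Set Implicit Arguments.
Unset Strict Implicit.
Unset Printing Implicit Defensive.

Import Order.TTheory GRing.Theory Num.Theory.
Local Open Scope classical_set_scope.
Local Open Scope ring_scope.

(** * Finite root systems *)

(** The obstacle is the roots of I orthogonal to theta. When gamma enters the chain, w_0 gamma =
    delta - alpha_i costs one unit in the coordinate of alpha_i; this is repaid by <theta, gamma^v>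
    >= 1, which fails exactly when gamma is orthogonal to theta. After the passage to u every nu of
    the chain is acute with theta. For gamma orthogonal to theta and |nu| <= |gamma| this gives
    |<gamma, nu^v>| / |gamma|^2 <= <theta, nu^v> / |theta|^2, and |gamma| = |alpha_j| makes it
    available at each step that moves the j-th coordinate. As (u theta)_j = 2 theta_j - mu_j = 2
    theta_j - 1, summation bounds (u gamma)_j by (|gamma|^2 / |theta|^2) (theta_j - 1), whereas the
    dominant tau, of the same norm and j-th coordinate, needs at least (|gamma|^2 / |theta|^2)
    theta_j. That u gamma has no delta-part comes from s_0 occurring only once in the chain of u,
    which makes the level of u y equal to <y, theta^v>. *)

Definition pairing (R : realType) (n : nat) (ip : 'rV[R]_n -> 'rV[R]_n -> R)
  (x y : 'rV[R]_n) : R := 2 * ip x y / ip y y.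

(* Not required to be reduced; irreducibility is a consequence of [root_max]. *)
Record root_system (R : realType) (n : nat) (ip : 'rV[R]_n -> 'rV[R]_n -> R)
    (D : set 'rV[R]_n) (theta : 'rV[R]_n) : Prop := RootSystem {
  root_ip : inner_product ip;
  root_neq0 : forall x, D x -> x <> 0;
  root_int : forall x y, D x -> D y -> pairing ip y x \is a Num.int;
  root_refl : forall x y, D x -> D y -> D (y - pairing ip y x *: x);
  root_sign : forall x, D x -> root_le 0 x \/ root_le 0 (- x);
  root_simple : forall i, D (simple_root R i);
  root_top : D theta;
  root_max : forall x, D x -> root_le 0 x -> root_le x theta
}.

Section RootSystem.
Context (R : realType) (n : nat) (ip : 'rV[R]_n -> 'rV[R]_n -> R).
Context (D : set 'rV[R]_n) (theta : 'rV[R]_n).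
Hypothesis rsD : root_system ip D theta.

Local Notation V := 'rV[R]_n.
Local Notation pr := (pairing ip).
Local Notation al := (@simple_root R n).

(** The order over the reals, without the integrality built into [root_le]: it applies to arbitrary
    vectors and suits linear arithmetic. Between roots the two agree by [root_coord_int]. *)
Definition vle (x y : V) := forall i, x 0 i <= y 0 i.

Let ipP := root_ip rsD.

Lemma ipC x y : ip x y = ip y x. Proof. by case: ipP. Qed.

Lemma ipDl (x y z : V) : ip (x + y) z = ip x z + ip y z.
Proof. by case: ipP => lin _ _; rewrite -[x]scale1r lin mul1r scale1r. Qed.

Lemma ip0l z : ip 0 z = 0.
Proof. by apply: (addrI (ip 0 z)); rewrite -ipDl !addr0. Qed.

Lemma ipZl c (x z : V) : ip (c *: x) z = c * ip x z.
Proof. by case: ipP => lin _ _; rewrite -[c *: x]addr0 lin ip0l addr0. Qed.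

Lemma ipNl (x z : V) : ip (- x) z = - ip x z.
Proof. by rewrite -scaleN1r ipZl mulN1r. Qed.

Lemma ipDr (x y z : V) : ip z (x + y) = ip z x + ip z y.
Proof. by rewrite ipC ipDl !(ipC _ z). Qed.

Lemma ipZr c (x z : V) : ip z (c *: x) = c * ip z x.
Proof. by rewrite ipC ipZl (ipC _ z). Qed.

Lemma ipNr (x z : V) : ip z (- x) = - ip z x.
Proof. by rewrite ipC ipNl (ipC _ z). Qed.

Lemma ip_suml (I : Type) (r : seq I) (P : pred I) (F : I -> V) z :
  ip (\sum_(i <- r | P i) F i) z = \sum_(i <- r | P i) ip (F i) z.
Proof. exact: (big_morph (ip^~ z) (fun x y => ipDl x y z) (ip0l z)). Qed.

Let ipE := (ipDl, ipDr, ipNl, ipNr, ipZl, ipZr).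

Lemma ip_gt0 x : x <> 0 -> 0 < ip x x. Proof. by case: ipP => _ _; apply. Qed.

Lemma ip_ge0 x : 0 <= ip x x.
Proof.
by have [->|/eqP/ip_gt0/ltW //] := eqVneq x 0; rewrite ip0l.
Qed.

Lemma ip_eq0 x : ip x x <= 0 -> x = 0.
Proof. by case: (eqVneq x 0) => // /eqP/ip_gt0; rewrite ltNge => /negP. Qed.

Lemma ip_root_gt0 x : D x -> 0 < ip x x.
Proof. by move=> Dx; apply/ip_gt0/(root_neq0 rsD). Qed.

Lemma ip_coord x y : ip x y = \sum_i x 0 i * ip (al i) y.
Proof.
rewrite {1}[x]row_sum_delta ip_suml.
by apply: eq_bigr => i _; rewrite ipZl.
Qed.

Lemma pairingE x y : D y -> pr x y * ip y y = 2 * ip x y.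
Proof.
move=> Dy; rewrite /pairing -mulrA mulVf ?mulr1 //.
by rewrite gt_eqF // ip_root_gt0.
Qed.

Lemma pairing_gt0 x y : D y -> (0 < pr x y) = (0 < ip x y).
Proof.
move=> Dy; have y0 := ip_root_gt0 Dy.
by rewrite -(pmulr_lgt0 _ y0) pairingE // pmulr_rgt0.
Qed.

Lemma pairing_lt0 x y : D y -> (pr x y < 0) = (ip x y < 0).
Proof.
move=> Dy; have y0 := ip_root_gt0 Dy.
by rewrite -(pmulr_llt0 _ y0) pairingE // pmulr_rlt0.
Qed.

Lemma pairing_self x : D x -> pr x x = 2.
Proof. by move=> Dx; rewrite /pairing mulfK // gt_eqF // ip_root_gt0. Qed.

Lemma pairingNl x y : pr (- x) y = - pr x y.
Proof. by rewrite /pairing ipNl mulrN mulNr. Qed.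

Lemma pairingDl x y z : pr (x + y) z = pr x z + pr y z.
Proof. by rewrite /pairing ipDl mulrDr mulrDl. Qed.

Lemma root_opp x : D x -> D (- x).
Proof.
move=> Dx; have := root_refl rsD Dx Dx; rewrite pairing_self //.
by rewrite scaler_nat mulr2n opprD addNKr.
Qed.

Lemma int_gt0_ge1 (x : R) : x \is a Num.int -> 0 < x -> 1 <= x.
Proof. by move=> /intrP[m ->]; rewrite ltr0z ler1z; lia. Qed.

Lemma int_lt2_le1 (x : R) : x \is a Num.int -> x < 2 -> x <= 1.
Proof. by move=> /intrP[m ->]; rewrite pmulrn ltr_int lerz1; lia. Qed.

(** From |x - y|^2 > 0 comes 2 (x, y) < |x|^2 + |y|^2 <= 2 |y|^2, so the integer <x, y^v> is below
    2. *)
Lemma pairing_le1 x y : D x -> D y -> ip x x <= ip y y -> x <> y -> pr x y <= 1.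
Proof.
move=> Dx Dy xy ne; apply: int_lt2_le1; first exact: (root_int rsD).
have y0 := ip_root_gt0 Dy.
have: 0 < ip (x - y) (x - y) by apply: ip_gt0 => /eqP; rewrite subr_eq0 => /eqP.
rewrite !ipE (ipC y x) => h.
rewrite -(ltr_pM2r y0) pairingE //; lra.
Qed.

(** The shorter root pairs to exactly -1 with the coroot of the longer, so a reflection performs the
    addition. *)
Lemma root_add x y : D x -> D y -> ip x y < 0 -> x <> - y -> D (x + y).
Proof.
suff main a b : D a -> D b -> ip a a <= ip b b -> ip a b < 0 -> a <> - b -> D (a + b).
  move=> Dx Dy xy0 ne; case: (leP (ip x x) (ip y y)) => [h|/ltW h]; first exact: main.
  rewrite addrC; apply: main => //; first by rewrite ipC.
  by move=> yx; apply: ne; rewrite yx opprK.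
move=> Da Db ab ab0 ne.
have h1 : pr (- a) b <= 1.
  apply: pairing_le1 => //; first exact: root_opp.
    by rewrite ipNl ipNr opprK.
  by move=> /(congr1 -%R); rewrite opprK.
have h2 : 1 <= pr (- a) b.
  apply: int_gt0_ge1; first by apply: (root_int rsD) => //; exact: root_opp.
  by rewrite pairing_gt0 // ipNl oppr_gt0.
have e : pr a b = -1 by move: h1 h2; rewrite pairingNl; lra.
by have := root_refl rsD Db Da; rewrite e scaleN1r opprK.
Qed.

Lemma root_sub x y : D x -> D y -> 0 < ip x y -> x <> y -> D (x - y).
Proof.
move=> Dx Dy xy ne; apply: root_add => //; first exact: root_opp.
  by rewrite ipNr oppr_lt0.
by rewrite opprK.
Qed.

Lemma root_coord_int x i : D x -> x 0 i \is a Num.int.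
Proof.
move=> Dx; case: (root_sign rsD Dx) => /(_ i); rewrite subr0 ?mxE.
  exact: intr_nat.
by move=> /intr_nat; rewrite rpredN.
Qed.

Lemma root_vle x : D x -> vle 0 x \/ vle 0 (- x).
Proof.
move=> Dx; case: (root_sign rsD Dx) => h; [left|right] => i;
  by rewrite mxE; move: (h i); rewrite subr0; exact: natr_ge0.
Qed.

Lemma vle0_root_le x : D x -> vle 0 x -> root_le 0 x.
Proof.
move=> Dx h i; rewrite subr0 natrEint root_coord_int //=.
by have := h i; rewrite mxE.
Qed.

Lemma root_le_top x : D x -> vle x theta.
Proof.
move=> Dx i.
suff pos y : D y -> vle 0 y -> y 0 i <= theta 0 i.
  case: (root_vle Dx) => h; first exact: pos.
  have th0 : 0 <= theta 0 i.
    by apply: le_trans (pos _ (root_opp Dx) h); have := h i; rewrite mxE.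
  by apply: le_trans th0; have := h i; rewrite !mxE oppr_ge0.
move=> Dy y0; have /(_ i) := root_max rsD Dy (vle0_root_le Dy y0).
by rewrite mxE => /natr_ge0; rewrite mxE subr_ge0.
Qed.

Lemma simpleE i j : al i 0 j = (i == j)%:R.
Proof. by rewrite /simple_root mxE eqxx eq_sym. Qed.

Lemma simple_diag i : al i 0 i = 1.
Proof. by rewrite simpleE eqxx. Qed.

Lemma simple_off i j : i != j -> al i 0 j = 0.
Proof. by rewrite simpleE => /negbTE->. Qed.

Lemma top_ge1 i : 1 <= theta 0 i.
Proof.
have := root_le_top (root_simple rsD i) i.
by rewrite simple_diag.
Qed.

Lemma root_pos_neg x : D x -> vle 0 x -> vle 0 (- x) -> False.
Proof.
move=> Dx h1 h2; apply: (root_neq0 rsD Dx); apply/rowP=> i.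
by have := h1 i; have := h2 i; rewrite !mxE; lra.
Qed.

(** Otherwise theta + alpha_i would be a root exceeding theta in coordinate i. *)
Lemma top_dom i : 0 <= ip theta (al i).
Proof.
rewrite leNgt; apply/negP => h.
have ne : theta <> - al i.
  move/(congr1 (fun v : V => v 0 i)); rewrite mxE simple_diag.
  by have := top_ge1 i; lra.
have := root_le_top (root_add (root_top rsD) (root_simple rsD i) h ne) i.
by rewrite mxE simple_diag; lra.
Qed.

Lemma dom_pos x y : (forall i, 0 <= ip x (al i)) -> vle 0 y -> 0 <= ip x y.
Proof.
move=> xd y0; rewrite ipC ip_coord; apply: sumr_ge0 => i _.
by apply: mulr_ge0; [have := y0 i; rewrite mxE|rewrite ipC].
Qed.

Lemma top_pos_ge0 x : vle 0 x -> 0 <= ip theta x.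
Proof. exact: dom_pos top_dom. Qed.

Lemma top_gt0_pos x : D x -> 0 < ip x theta -> vle 0 x.
Proof.
move=> Dx h; case: (root_vle Dx) => // /top_pos_ge0.
by rewrite ipNr ipC; lra.
Qed.

(** Otherwise alpha_i - alpha_j would be a root with coordinates of both signs. *)
Lemma simple_obtuse i j : i != j -> ip (al i) (al j) <= 0.
Proof.
move=> ne; rewrite leNgt; apply/negP => h.
have e : al i <> al j.
  move/(congr1 (fun v : V => v 0 i)); rewrite simple_diag simple_off 1?eq_sym //.
  by move/eqP; rewrite oner_eq0.
have := root_vle (root_sub (root_simple rsD i) (root_simple rsD j) h e).
case=> [/(_ j)|/(_ i)]; rewrite mxE [X in _ <= X]mxE.
  by rewrite [X in _ + X]mxE simple_diag simple_off //; lra.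
by rewrite mxE [X in _ + X]mxE simple_diag simple_off 1?eq_sym //; lra.
Qed.

Definition ht (x : V) : R := \sum_i x 0 i.

(** Well founded because heights of roots are integers; for [root_ind_up] they are moreover bounded
    by [ht theta]. *)
Lemma root_ind_down (P : V -> Prop) :
  (forall x, D x -> vle 0 x ->
     (forall y, D y -> vle 0 y -> ht y < ht x -> P y) -> P x) ->
  forall x, D x -> vle 0 x -> P x.
Proof.
move=> step.
suff gen (N : nat) : forall x, D x -> vle 0 x -> ht x < N%:R -> P x.
  move=> x Dx x0; apply: (gen (Num.bound (ht x))) => //.
  by apply: le_lt_trans (archi_boundP _) => //; apply: sumr_ge0 => i _;
    have := x0 i; rewrite mxE.
elim: N => [|N IH] x Dx x0 hx.
  by move: hx; rewrite ltNge sumr_ge0 // => i _; have := x0 i; rewrite mxE.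
apply: step => // y Dy y0 yx; apply: IH => //.
have hI z : D z -> ht z \is a Num.int.
  by move=> Dz; apply: rpred_sum => i _; exact: root_coord_int.
move: (hI _ Dx) (hI _ Dy) yx hx => /intrP[a ->] /intrP[b ->].
by rewrite !pmulrn !ltr_int; lia.
Qed.

Lemma root_ind_up (P : V -> Prop) :
  (forall x, D x -> vle 0 x ->
     (forall y, D y -> vle 0 y -> ht x < ht y -> P y) -> P x) ->
  forall x, D x -> vle 0 x -> P x.
Proof.
move=> step.
suff gen (N : nat) : forall x, D x -> vle 0 x -> ht theta - ht x < N%:R -> P x.
  move=> x Dx x0; apply: (gen (Num.bound (ht theta - ht x))) => //.
  apply: le_lt_trans (archi_boundP _) => //; rewrite subr_ge0.
  by apply: ler_sum => i _; exact: root_le_top.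
elim: N => [|N IH] x Dx x0 hx.
  move: hx; rewrite ltNge subr_ge0.
  by rewrite (ler_sum _ (fun i _ => root_le_top Dx i)).
apply: step => // y Dy y0 yx; apply: IH => //.
have hI z : D z -> ht z \is a Num.int.
  by move=> Dz; apply: rpred_sum => i _; exact: root_coord_int.
move: (hI _ Dx) (hI _ Dy) (hI _ (root_top rsD)) yx hx => /intrP[a ->] /intrP[b ->] /intrP[c ->].
by rewrite !pmulrn -!intrB !ltr_int; lia.
Qed.


Lemma coordBZ (x y : V) c k : (x - c *: y) 0 k = x 0 k - c * y 0 k.
Proof. by rewrite !mxE. Qed.

Lemma coordN (x : V) k : (- x) 0 k = - x 0 k.
Proof. by rewrite mxE. Qed.

Lemma coord0 k : (0 : V) 0 k = 0.
Proof. by rewrite mxE. Qed.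

Lemma vle0P (x : V) : vle 0 x <-> forall k, 0 <= x 0 k.
Proof. by split=> h k; have := h k; rewrite coord0. Qed.

Lemma refl_adj (a x y : V) : ip (x - pr x a *: a) y = ip x (y - pr y a *: a).
Proof. by rewrite !ipE /pairing (ipC a y); ring. Qed.

Lemma reflK (a x : V) : D a ->
  (x - pr x a *: a) - pr (x - pr x a *: a) a *: a = x.
Proof.
move=> Da; have -> : pr (x - pr x a *: a) a = - pr x a.
  by rewrite /pairing !ipE; field; rewrite gt_eqF // ip_root_gt0.
by rewrite scaleNr opprK subrK.
Qed.

Lemma refl_iso (a x : V) : D a ->
  ip (x - pr x a *: a) (x - pr x a *: a) = ip x x.
Proof. by move=> Da; rewrite refl_adj reflK. Qed.

Lemma ht_simple_sub (x : V) c i : ht (x - c *: al i) = ht x - c.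
Proof.
rewrite /ht -{2}[c]mulr1 -(simple_diag i).
under eq_bigr do rewrite coordBZ.
rewrite sumrB; congr (_ - _); rewrite (bigD1 i) //= big1 ?addr0 // => k ik.
by rewrite simple_off ?mulr0 // eq_sym.
Qed.

(** Only the i-th coordinate changes, so a change of sign forces all the others to vanish. *)
Lemma simple_refl_pos x i : D x -> vle 0 x ->
  vle 0 (x - pr x (al i) *: al i) \/ x = x 0 i *: al i.
Proof.
move=> Dx x0; case: (root_vle (root_refl rsD (root_simple rsD i) Dx)); first by left.
move=> h; right; apply/rowP => k; rewrite [RHS]mxE.
have [->|ik] := eqVneq i k; first by rewrite simple_diag mulr1.
rewrite simple_off // mulr0; have := h k; have := x0 k.
rewrite coordN coordBZ coord0 simple_off //; lra.
Qed.

(** Otherwise |x|^2 = sum_i x_i (x, alpha_i) would be at most 0. *)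
Lemma exists_simple_acute x : D x -> vle 0 x -> exists i, 0 < ip x (al i).
Proof.
move=> Dx x0; apply: contrapT => /forallNP no.
suff: ip x x <= 0 by rewrite leNgt ip_root_gt0.
rewrite ip_coord -oppr_ge0 -sumrN; apply: sumr_ge0 => i _.
have := x0 i; rewrite mxE => xi; have /negP := no i; rewrite -leNgt ipC => hi.
by rewrite -mulrN mulr_ge0 // oppr_ge0.
Qed.

(* Descending by simple reflections, the j-th coordinate of a root b changes by
   multiples of N = |b|^2 / |alpha_j|^2, and it ends at 0 or at a coordinate c
   with c^2 = N. *)
Lemma long_coord_neq1 b j : D b -> vle 0 b ->
  ip (al j) (al j) < ip b b -> b 0 j <> 1.
Proof.
move=> Db b0 lt; have aj := ip_root_gt0 (root_simple rsD j).
pose N := ip b b / ip (al j) (al j).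
have N1 : 1 < N by rewrite ltr_pdivlMr // mul1r.
have NE : N * ip (al j) (al j) = ip b b by rewrite divfK // gt_eqF.
pose P x := ip x x = ip b b -> exists c z : R,
  [/\ c \is a Num.int, z \is a Num.int, c = 0 \/ c ^+ 2 = N & x 0 j = c + N * z].
suff /(_ (erefl _)) [c [z [cI zI hc ->]]] : P b.
  case: hc => [->|cN] e.
    have : 0 < z.
      by rewrite -(pmulr_rgt0 _ (lt_trans ltr01 N1)) -[N * z]add0r e ltr01.
    by move=> /(int_gt0_ge1 zI) z1; move: e; nra.
  (* The equation c + c^2 z = 1 exhibits the integer c as a unit, against c^2 = N > 1. *)
  have ce : c * (1 + c * z) = 1 by rewrite mulrDr mulr1 mulrA -expr2 cN.
  have c0 : c != 0 by apply: contra_eq_neq ce => ->; rewrite mul0r eq_sym oner_neq0.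
  have d0 : 1 + c * z != 0.
    by apply: contra_eq_neq ce => ->; rewrite mulr0 eq_sym oner_neq0.
  have h1 := sqr_intr_ge1 cI c0.
  have h2 : 1 <= (1 + c * z) ^+ 2.
    by apply: sqr_intr_ge1 d0; rewrite rpredD ?rpredM ?rpred1.
  have h3 : c ^+ 2 * (1 + c * z) ^+ 2 = 1 by rewrite -exprMn ce expr1n.
  by move: h3; rewrite cN; nra.
apply: (root_ind_down _ Db b0) => x Dx x0 IH xb.
have [i xi] := exists_simple_acute Dx x0.
have Di := root_simple rsD i.
have pI : pr (al i) x \is a Num.int by exact: (root_int rsD).
case: (simple_refl_pos i Dx x0) => [y0|xE].
  have Dy := root_refl rsD Di Dx.
  have hy : ht (x - pr x (al i) *: al i) < ht x.
    rewrite ht_simple_sub.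
    by rewrite ltrBlDr ltrDl pairing_gt0.
  have [c [z [cI zI hc e]]] := IH _ Dy y0 hy (etrans (refl_iso x Di) xb).
  have xj : x 0 j = c + N * z + pr x (al i) * al i 0 j.
    by rewrite -e coordBZ; ring.
  have [ij|ij] := eqVneq i j; last first.
    by exists c, z; split => //; rewrite xj simple_off // mulr0 addr0.
  exists c, (z + pr (al i) x); split => //; first by rewrite rpredD.
  have -> : pr (al i) x = pr x (al i) / N.
    rewrite /N -xb ij /pairing (ipC _ x); field.
    by rewrite !gt_eqF // ip_root_gt0.
  rewrite xj ij simple_diag mulr1 mulrDr addrA; congr (_ + _).
  by rewrite mulrCA mulfV ?mulr1 // gt_eqF // (lt_trans ltr01).
have [ij|ij] := eqVneq i j.
  exists (x 0 j), 0; split; rewrite ?rpred0 ?mulr0 ?addr0 //.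
    exact: root_coord_int.
  right; rewrite /N -xb xE ij ipZl ipZr -ij mxE simple_diag.
  by rewrite ij; field; rewrite gt_eqF.
exists 0, 0; split; rewrite ?rpred0 ?mulr0 ?addr0 //; first by left.
by rewrite xE mxE simple_off ?mulr0.
Qed.

(* The condition on g makes every simple root a with (g, a) < 0 orthogonal to m, and
   it is inherited by s_a g; so g climbs to a dominant root by reflections in simple
   roots orthogonal to m. *)
Lemma climb_to_dom m g : D g -> vle 0 g ->
  (forall z, D z -> 0 < ip z g -> ip z m <> 0 -> vle 0 z) ->
  exists x, [/\ D x, forall i, 0 <= ip x (al i), ip x x = ip g g
    & forall j, ip m (al j) <> 0 -> x 0 j = g 0 j].
Proof.
move: g; apply: root_ind_up => g Dg g0 IH gP.
case: (pselect (forall i, 0 <= ip g (al i))) => [gd|]; first by exists g.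
move/existsNP => [a /negP]; rewrite -ltNge => ga.
have Da := root_simple rsD a.
(* If (m, alpha_a) were nonzero, the hypothesis on g would make - alpha_a positive. *)
have ma : ip m (al a) = 0.
  apply: contrapT => ma; apply: (root_pos_neg (root_opp Da)); last first.
    by rewrite opprK => i; rewrite mxE simpleE ler0n.
  apply: gP; first exact: root_opp.
    by rewrite ipNl oppr_gt0 ipC.
  by rewrite ipNl ipC => /eqP; rewrite oppr_eq0 => /eqP.
pose s x := x - pr x (al a) *: al a.
have Ds x : D x -> D (s x) by exact: (root_refl rsD Da).
have g0' : vle 0 (s g).
  move=> i; have := g0 i; rewrite coordBZ coord0.
  have : pr g (al a) < 0 by rewrite pairing_lt0.
  by rewrite simpleE; case: (a == i) => /=; lra.
have [||x [Dx xd xx xj]] := IH (s g) (Ds _ Dg) g0'.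
- by rewrite ht_simple_sub ltrDl oppr_gt0 pairing_lt0.
(* Since s_a fixes m, the hypothesis for g applies to s_a z. Positivity passes back to z unless s_a
   z is a multiple of alpha_a, which is orthogonal to m. *)
- move=> z Dz zg zm; have zE : s (s z) = z by exact: reflK.
  have Dz' := Ds _ Dz.
  have zm' : ip (s z) m <> 0.
    by rewrite refl_adj /pairing ma mulr0 mul0r scale0r subr0.
  have z'0 : vle 0 (s z) by apply: gP => //; rewrite refl_adj.
  have [|e] := simple_refl_pos a Dz' z'0; first by rewrite -/(s (s z)) zE.
  by case: zm'; rewrite e ipZl ipC ma mulr0.
exists x; split => //; first by rewrite xx refl_iso.
move=> j mj; rewrite xj // /s coordBZ simple_off ?mulr0 ?subr0 //.
by apply/eqP => e; apply: mj; rewrite -e.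
Qed.

(** With m = 0 the constraint in [climb_to_dom] is vacuous, so x has the norm of a dominant root z;
    pairing theta - z >= 0 with z and with theta gives |z|^2 <= (theta, z) <= |theta|^2. *)
Lemma root_long x : D x -> ip x x <= ip theta theta.
Proof.
suff pos y : D y -> vle 0 y -> ip y y <= ip theta theta.
  move=> Dx; case: (root_vle Dx); first exact: pos.
  by move=> /(pos _ (root_opp Dx)); rewrite ipNl ipNr opprK.
move=> Dy y0; have [|z [Dz zd zn _]] := climb_to_dom (m := 0) Dy y0.
  by move=> z _ _; rewrite ipC ip0l.
rewrite -zn; have zle : vle 0 (theta - z).
  by apply/vle0P => i; rewrite !mxE subr_ge0; exact: root_le_top.
have := dom_pos zd zle; have := top_pos_ge0 zle.
rewrite !ipE (ipC z theta); lra.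
Qed.

Lemma pairing_top x : D x -> x <> theta -> x <> - theta ->
  -1 <= pr x theta <= 1.
Proof.
move=> Dx n1 n2; rewrite (pairing_le1 Dx (root_top rsD) _ n1) ?root_long // andbT.
rewrite lerNl -pairingNl pairing_le1 //; [exact: root_opp|exact: root_top rsD| |].
  by rewrite ipNl ipNr opprK root_long.
by move/(congr1 -%R); rewrite opprK.
Qed.

(** If |g| <= |v|, the left side is at most 1 and the right side at least 1. Otherwise multiply by
    |v|^2 and turn both pairings around: <v, g^v> |g|^2 <= |g|^2 <= |theta|^2 <= <v, theta^v>
    |theta|^2. *)
Lemma pairing_le_top g v : D g -> D v -> 0 < ip v theta -> g <> v ->
  pr g v <= pr theta v.
Proof.
move=> Dg Dv vt ne; have v0 := ip_root_gt0 Dv; have g0 := ip_root_gt0 Dg.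
have Dt := root_top rsD; have tv : 0 < pr theta v by rewrite pairing_gt0 // ipC.
have tv1 := int_gt0_ge1 (root_int rsD Dv Dt) tv.
case: (leP (ip g g) (ip v v)) => [h|/ltW h].
  exact: le_trans (pairing_le1 Dg Dv h ne) tv1.
have vt1 : 1 <= pr v theta by apply: int_gt0_ge1 (root_int rsD Dt Dv) _; rewrite pairing_gt0.
have vg1 : pr v g <= 1 by apply: pairing_le1 => // /esym.
rewrite -(ler_pM2r v0) !pairingE // (ipC g) (ipC theta) -!pairingE //.
have := root_long Dg; have := ip_root_gt0 Dt; nra.
Qed.

(** The pairings turned around satisfy |<v, g^v>| <= 1 <= <v, theta^v>; exchanging the arguments
    brings in the squared norms. *)
Lemma pairing_perp_le g v : D g -> D v -> 0 < ip v theta -> ip g theta = 0 ->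
  ip v v <= ip g g -> ip theta theta * `|pr g v| <= ip g g * pr theta v.
Proof.
move=> Dg Dv vt gt vg; have v0 := ip_root_gt0 Dv; have g0 := ip_root_gt0 Dg.
have Dt := root_top rsD; have t0 := ip_root_gt0 Dt.
have vt1 : 1 <= pr v theta by apply: int_gt0_ge1 (root_int rsD Dt Dv) _; rewrite pairing_gt0.
have b1 : pr v g <= 1.
  by apply: pairing_le1 => // e; move: vt; rewrite e gt ltxx.
have b2 : pr (- v) g <= 1.
  apply: pairing_le1 => //; [exact: root_opp | by rewrite ipNl ipNr opprK|].
  by move/(congr1 -%R); rewrite opprK => e; move: vt; rewrite e ipNl gt oppr0 ltxx.
have nE : `|pr g v| * ip v v = `|pr v g| * ip g g.
  rewrite -[X in _ * X = _](gtr0_norm v0) -[X in _ = _ * X](gtr0_norm g0).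
  by rewrite -!normrM !pairingE // (ipC g).
rewrite -(ler_pM2r v0) -mulrA nE -mulrA pairingE // (ipC theta) -(pairingE v) //.
have b3 : `|pr v g| <= 1 by rewrite ler_norml b1 andbT lerNl -pairingNl.
have -> : ip g g * (pr v theta * ip theta theta) = ip theta theta * (pr v theta * ip g g) by ring.
by rewrite ler_wpM2l ?(ltW t0) // ler_wpM2r ?(ltW g0) // (le_trans b3).
Qed.

(** For x different from theta, <x, theta^v> = 1 and so <theta, x^v> = |theta|^2 / |x|^2. The root
    s_x theta has negative product with the dominant x, hence is a negative root, which is the
    inequality. *)
Lemma dom_root_ge x j : D x -> (forall i, 0 <= ip x (al i)) ->
  theta 0 j * ip x x <= ip theta theta * x 0 j.
Proof.
move=> Dx xd; have Dt := root_top rsD; have x0 := ip_root_gt0 Dx.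
have xt0 : 0 < ip x theta.
  have xp : vle 0 x.
    case: (root_vle Dx) => // /(dom_pos xd); rewrite ipNr oppr_ge0 => h.
    by move: x0; rewrite ltNge h.
  have [i xi] := exists_simple_acute Dx xp.
  rewrite ipC ip_coord (bigD1 i) //=.
  apply: ltr_wpDr; last by apply: mulr_gt0; [apply: lt_le_trans (top_ge1 i)|rewrite ipC].
  by apply: sumr_ge0 => k _; apply: mulr_ge0; [have := top_ge1 k; lra | rewrite ipC].
have [->|/eqP ne] := eqVneq x theta; first by rewrite mulrC.
have p1 : pr x theta = 1.
  apply/eqP; rewrite eq_le pairing_le1 //= ?root_long //.
  by apply: int_gt0_ge1; [exact: (root_int rsD) | rewrite pairing_gt0].
have tE : pr theta x * ip x x = ip theta theta.
  by rewrite pairingE // ipC -(pairingE x Dt) p1 mul1r.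
have Ds := root_refl rsD Dx Dt.
have neg : vle 0 (- (theta - pr theta x *: x)).
  case: (root_vle Ds) => // /(dom_pos xd).
  by have := pairingE theta Dx; rewrite !ipE (ipC theta) => ->; lra.
have := neg j; rewrite coordN coordBZ coord0 -tE; nra.
Qed.


(* Since g is orthogonal to theta, dominance of theta kills theta on the support
   of g; if that support contained j, theta would split off an orthogonal part. *)
Lemma perp_obstruction g j : D g -> vle 0 g -> ip g theta = 0 ->
  (forall i, i != j -> 0 <= ip g (al i)) -> ip g (al j) < 0 /\ g 0 j = 0.
Proof.
move=> Dg /vle0P g0 gt gi; split.
  rewrite ltNge; apply/negP => gj.
  have gd i : 0 <= ip g (al i) by case: (eqVneq i j) => [->|/gi].
  have : forall i, ip g (al i) = 0.
    move=> i; have := gt; rewrite ipC ip_coord => /eqP; rewrite psumr_eq0; last first.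
      by move=> k _; rewrite mulr_ge0 // ?(ipC _ g) // (le_trans ler01 (top_ge1 k)).
    move=> /allP/(_ i (mem_index_enum _)); rewrite mulf_eq0 => /orP[/eqP ti|/eqP].
      by have := top_ge1 i; rewrite ti ler10.
    by rewrite ipC.
  move=> gz; have := ip_root_gt0 Dg; rewrite ip_coord big1 ?ltxx // => i _.
  by rewrite ipC gz mulr0.
apply: contrapT => gj0.
have tz i : g 0 i <> 0 -> ip theta (al i) = 0.
  move=> gi0; have := gt; rewrite ip_coord => /eqP; rewrite psumr_eq0; last first.
    by move=> k _; rewrite mulr_ge0 // (ipC _ theta) top_dom.
  move=> /allP/(_ i (mem_index_enum _)); rewrite mulf_eq0 => /orP[/eqP //|/eqP].
  by rewrite ipC.
(* For i outside the support of g every term g_k (alpha_k, alpha_i) is at most 0 while the sum is at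
   least 0; so the support is orthogonal to the other simple roots. *)
have off a i : g 0 a <> 0 -> g 0 i = 0 -> ip (al a) (al i) = 0.
  move=> ga gi0.
  have ij : i != j by apply/eqP => e; apply: gj0; rewrite -e.
  have le0 k : g 0 k * ip (al k) (al i) <= 0.
    have [->|ki] := eqVneq k i; first by rewrite gi0 mul0r.
    by rewrite mulr_ge0_le0 // simple_obtuse.
  have /eqP : \sum_k - (g 0 k * ip (al k) (al i)) = 0.
    apply/eqP; rewrite eq_le sumr_ge0 ?andbT; last by move=> k _; rewrite oppr_ge0.
    by rewrite sumrN oppr_le0 -ip_coord gi.
  rewrite psumr_eq0; last by move=> k _; rewrite oppr_ge0.
  move=> /allP/(_ a (mem_index_enum _)); rewrite oppr_eq0 mulf_eq0 => /orP[/eqP //|/eqP //].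
(* The part of theta on the support of g. It is orthogonal to theta and to theta - [tA], hence to
   itself. *)
pose tA : V := \row_i (if g 0 i == 0 then 0 else theta 0 i).
have tA_eq0 : tA = 0.
  apply: ip_eq0; rewrite -(_ : ip tA theta = ip tA tA).
    rewrite ip_coord big1 // => i _; rewrite mxE.
    case: eqP => [_|/tz]; first by rewrite mul0r.
    by rewrite (ipC _ theta) => ->; rewrite mulr0.
  apply/eqP; rewrite -subr_eq0 -ipNr -ipDr; apply/eqP.
  rewrite ip_coord big1 // => a _; rewrite mxE.
  case: eqP => [_|ga]; first by rewrite mul0r.
  rewrite ipC ip_coord big1 ?mulr0 // => i _; rewrite !mxE.
  case: eqP => [gi0|_]; last by rewrite subrr mul0r.
  by rewrite (ipC (al i)) off // mulr0.
have := congr1 (fun v : V => v 0 j) tA_eq0; rewrite !mxE; case: eqP => // _ tj.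
by have := top_ge1 j; rewrite tj ler10.
Qed.

End RootSystem.

(** * Affine roots and minuscule elements *)

Section AffineRoots.
Context (R : realType) (n : nat) (ip : 'rV[R]_n -> 'rV[R]_n -> R).
Context (D : set 'rV[R]_n) (theta : 'rV[R]_n).
Hypothesis rsD : root_system ip D theta.

Local Notation V := 'rV[R]_n.
Local Notation hV := (hatV R n).
Local Notation pr := (pairing ip).
Local Notation al := (@simple_root R n).
Local Notation hf := (hat_form ip).
Local Notation asr := (affine_simple_root theta).
Local Notation refl := (affine_reflection ip theta).
Local Notation dl := (delta R n).

Let ipE := (ipDl rsD, ipDr rsD, ipNl rsD, ipNr rsD, ipZl rsD, ipZr rsD).

Lemma hatV_eq (x y : hV) : x.1.1 = y.1.1 -> x.1.2 = y.1.2 -> x.2 = y.2 -> x = y.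
Proof. by case: x => [[x a] b]; case: y => [[y c] d] /= -> -> ->. Qed.

(* Coordinates in the basis of affine simple roots, for vectors in V + R delta. *)
Definition acoord (i : 'I_n.+1) (x : hV) : R :=
  if unlift ord0 i is Some j then x.1.1 0 j + x.1.2 * theta 0 j else x.1.2.

Definition hpos (x : hV) := forall i, 0 <= acoord i x.

Definition real_root (x : hV) := [/\ D x.1.1, (x.1.2 : R) \is a Num.int & x.2 = 0].

(** At [asr i] this unfolds to [affine_reflection]; the exchange argument uses it at arbitrary real
    roots. *)
Definition hrefl (b x : hV) : hV := x - hf x b *: hat_coroot ip b.

Lemma acoord0 x : acoord ord0 x = x.1.2.
Proof. by rewrite /acoord unlift_none. Qed.

Lemma acoord_lift j x : acoord (lift ord0 j) x = x.1.1 0 j + x.1.2 * theta 0 j.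
Proof. by rewrite /acoord liftK. Qed.

Lemma asr0 : asr ord0 = dl - inV theta.
Proof. by rewrite /affine_simple_root unlift_none. Qed.

Lemma asr_lift j : asr (lift ord0 j) = inV (al j).
Proof. by rewrite /affine_simple_root liftK. Qed.

Lemma acoordD i x y : acoord i (x + y) = acoord i x + acoord i y.
Proof. by rewrite /acoord; case: unlift => [j|] //=; rewrite mxE; ring. Qed.

Lemma acoordZ i c x : acoord i (c *: x) = c * acoord i x.
Proof. by rewrite /acoord; case: unlift => [j|] //=; rewrite mxE mulrDr mulrA. Qed.

Lemma acoordN i x : acoord i (- x) = - acoord i x.
Proof. by rewrite -scaleN1r acoordZ mulN1r. Qed.

Lemma acoordB i x y : acoord i (x - y) = acoord i x - acoord i y.
Proof. by rewrite acoordD acoordN. Qed.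

Lemma acoord_asr i k : acoord k (asr i) = (i == k)%:R.
Proof.
case: (unliftP ord0 i) => [j ->|->]; case: (unliftP ord0 k) => [l ->|->].
- by rewrite acoord_lift asr_lift /= mul0r addr0 (inj_eq (@lift_inj _ _)) simpleE.
- by rewrite acoord0 asr_lift.
- by rewrite acoord_lift asr0 /= !mxE; ring.
- by rewrite acoord0 asr0 /= oppr0 addr0.
Qed.

Lemma acoord_decomp (x : hV) : x.2 = 0 ->
  x = acoord ord0 x *: asr ord0 + inV (\row_j acoord (lift ord0 j) x).
Proof.
case: x => [[x a] b] /= ->; rewrite acoord0 asr0; apply: hatV_eq => /=.
- by apply/rowP => j; rewrite !mxE acoord_lift /=; ring.
- by rewrite oppr0 !addr0 -[LHS]mulr1.
- by rewrite oppr0 !addr0 scaler0.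
Qed.

Lemma acoord_inj (x y : hV) : x.2 = 0 -> y.2 = 0 ->
  (forall i, acoord i x = acoord i y) -> x = y.
Proof.
move=> x2 y2 e; rewrite (acoord_decomp x2) (acoord_decomp y2) e.
by congr (_ + inV _); apply/rowP => j; rewrite !mxE e.
Qed.

Lemma hfC x y : hf x y = hf y x.
Proof. by rewrite /hat_form (ipC rsD); ring. Qed.

Lemma hfDl x y z : hf (x + y) z = hf x z + hf y z.
Proof. by rewrite /hat_form /= !ipE; ring. Qed.

Lemma hfZl c x z : hf (c *: x) z = c * hf x z.
Proof.
rewrite /hat_form /= !ipE -[c *: x.1.2]/(c * x.1.2) -[c *: x.2]/(c * x.2); ring.
Qed.

Lemma hfNl x z : hf (- x) z = - hf x z.
Proof. by rewrite -scaleN1r hfZl mulN1r. Qed.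

Lemma hfDr x y z : hf z (x + y) = hf z x + hf z y.
Proof. by rewrite hfC hfDl !(hfC _ z). Qed.

Lemma hfZr c x z : hf z (c *: x) = c * hf z x.
Proof. by rewrite hfC hfZl (hfC _ z). Qed.

Lemma hfNr x z : hf z (- x) = - hf z x.
Proof. by rewrite hfC hfNl (hfC _ z). Qed.

Let hfE := (hfDl, hfDr, hfNl, hfNr, hfZl, hfZr).

Lemma hf_level0 (x y : hV) : x.2 = 0 -> y.2 = 0 -> hf x y = ip x.1.1 y.1.1.
Proof. by rewrite /hat_form => -> ->; rewrite mulr0 mul0r !addr0. Qed.

Lemma asr_root i : real_root (asr i).
Proof.
case: (unliftP ord0 i) => [j ->|->]; rewrite ?asr_lift ?asr0; split => //=.
- exact: (root_simple rsD).
- by rewrite add0r; apply: (root_opp rsD); apply: (root_top rsD).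
- by rewrite oppr0 addr0 rpred1.
- by rewrite oppr0 addr0.
Qed.

Lemma hf_root_gt0 b : real_root b -> 0 < hf b b.
Proof. by case=> Db _ b2; rewrite hf_level0 //; apply: ip_root_gt0 rsD _ Db. Qed.

Lemma real_rootN b : real_root b -> real_root (- b).
Proof.
case=> Db b1 b2; split => /=; first exact: root_opp rsD _ Db.
  by rewrite rpredN.
by rewrite b2 oppr0.
Qed.

Lemma hreflE b x : hrefl b x = x - (2 * hf x b / hf b b) *: b.
Proof. by rewrite /hrefl /hat_coroot scalerA mulrA (mulrC _ 2). Qed.

Lemma hreflD b x y : hrefl b (x + y) = hrefl b x + hrefl b y.
Proof.
by rewrite /hrefl hfDl scalerDl opprD addrACA.
Qed.

Lemma hreflZ b c x : hrefl b (c *: x) = c *: hrefl b x.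
Proof. by rewrite /hrefl hfZl scalerBr -scalerA. Qed.

Lemma hrefl_hf b x y : real_root b -> hf (hrefl b x) (hrefl b y) = hf x y.
Proof.
move=> rb; rewrite !hreflE !hfE (hfC b y); field.
by rewrite gt_eqF // hf_root_gt0.
Qed.

Lemma hreflK b x : real_root b -> hrefl b (hrefl b x) = x.
Proof.
move=> rb; rewrite {1}hreflE; have -> : 2 * hf (hrefl b x) b / hf b b = - (2 * hf x b / hf b b).
  by rewrite hreflE !hfE; field; rewrite gt_eqF // hf_root_gt0.
by rewrite hreflE scaleNr opprK subrK.
Qed.

Lemma hrefl_root b x : real_root b -> real_root x -> real_root (hrefl b x).
Proof.
case=> Db b1 b2 [Dx x1 x2].
have pE : 2 * hf x b / hf b b = pr x.1.1 b.1.1 by rewrite !hf_level0.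
rewrite hreflE pE; split => /=.
- exact: (root_refl rsD).
- by rewrite rpredB // rpredM // (root_int rsD).
- by rewrite b2 x2 scaler0 subr0.
Qed.

Lemma hrefl_delta b : b.2 = 0 -> hrefl b dl = dl.
Proof.
move=> b2; rewrite hreflE; have -> : hf dl b = 0.
  by rewrite /hat_form /= (ip0l rsD) b2; ring.
by rewrite mulr0 mul0r scale0r subr0.
Qed.

(** [hpos_flip] identifies a root only up to a scalar, which the reflection does not see. *)
Lemma hrefl_scale c b : c != 0 -> hrefl (c *: b) = hrefl b.
Proof.
move=> c0; apply/funext => x; rewrite /hrefl /hat_coroot !scalerA; congr (_ - _ *: _).
rewrite !hfE; have [->|b0] := eqVneq (hf b b) 0; first by rewrite !mulr0 invr0 !mulr0 mul0r.
by field; rewrite c0 b0.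
Qed.

(** At level at least 1 the coordinates are nonnegative because theta bounds the root - x; at level
    0 this is the sign of a root of [D]. *)
Lemma hpos_or b : real_root b -> hpos b \/ hpos (- b).
Proof.
suff pos1 (x : hV) : real_root x -> 1 <= (x.1.2 : R) -> hpos x.
  move=> rb; have [Db bI b2] := rb; have [b1|b1|b1] := ltgtP (b.1.2 : R) 0.
  - right; apply: pos1; first exact: real_rootN.
    by apply: int_gt0_ge1; rewrite /= ?rpredN // oppr_gt0.
  - by left; apply: pos1 => //; apply: int_gt0_ge1.
  have key (s : R) : (forall j, 0 <= s * b.1.1 0 j) -> forall i, 0 <= s * acoord i b.
    move=> h i; case: (unliftP ord0 i) => [j ->|->].
      by rewrite acoord_lift b1 mul0r addr0.
    by rewrite acoord0 b1 mulr0.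
  case: (root_vle rsD Db) => /vle0P h; [left|right] => i.
    by rewrite -[acoord _ _]mul1r; apply: key => j; rewrite mul1r.
  rewrite acoordN -mulN1r; apply: key => j; rewrite mulN1r.
  by have := h j; rewrite coordN.
move=> [Dx xI x2] x1 i; case: (unliftP ord0 i) => [j ->|->]; last first.
  by rewrite acoord0 (le_trans ler01).
rewrite acoord_lift; have := root_le_top rsD (root_opp rsD Dx) j; rewrite coordN.
have := top_ge1 rsD j; nra.
Qed.

Lemma hpos_not b : real_root b -> hpos b -> hpos (- b) -> False.
Proof.
move=> rb h1 h2; have [Db _ b2] := rb.
have b0 : b = 0.
  apply: acoord_inj => // i; have := h1 i; have := h2 i; rewrite acoordN.
  have -> : acoord i 0 = 0 by rewrite -(scale0r (0 : hV)) acoordZ mul0r.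
  lra.
by apply: (root_neq0 rsD Db); rewrite b0.
Qed.

Lemma acoord_refl i k x : i != k -> acoord i (hrefl (asr k) x) = acoord i x.
Proof.
by move=> ik; rewrite hreflE acoordB acoordZ acoord_asr eq_sym (negbTE ik) mulr0 subr0.
Qed.

(* The only positive roots made negative by a simple reflection are multiples of
   the simple root; multiples other than 1 need not be excluded below. *)
Lemma hpos_flip k b : real_root b -> hpos b -> hpos (- hrefl (asr k) b) ->
  b = acoord k b *: asr k /\ acoord k b != 0.
Proof.
move=> rb h1 h2; have [Db _ b2] := rb; have [_ _ k2] := asr_root k.
have e : b = acoord k b *: asr k.
  apply: acoord_inj => //; first by rewrite /= k2 scaler0.
  move=> i; rewrite acoordZ acoord_asr; have [->|ik] := eqVneq k i; first by rewrite mulr1.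
  have := h1 i; have := h2 i; rewrite acoordN acoord_refl 1?eq_sym // mulr0; lra.
split => //; apply/eqP => c0; apply: (root_neq0 rsD Db).
by rewrite e c0 scale0r.
Qed.


(** * Words in the simple reflections and the exchange condition *)

Definition word (s : seq 'I_n.+1) : hV -> hV :=
  foldr (fun i w => hrefl (asr i) \o w) id s.

Lemma affine_weyl_word w : affine_weyl ip theta w -> exists s, w = word s.
Proof.
elim=> [|r v [i ->] _ [s ->]]; first by exists [::].
by exists (i :: s).
Qed.

Lemma wordD s x y : word s (x + y) = word s x + word s y.
Proof. by elim: s => //= i s ->; exact: hreflD. Qed.

Lemma wordZ s c x : word s (c *: x) = c *: word s x.
Proof. by elim: s => //= i s ->; exact: hreflZ. Qed.

Lemma wordN s x : word s (- x) = - word s x.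
Proof. by rewrite -scaleN1r wordZ scaleN1r. Qed.

Lemma wordB s x y : word s (x - y) = word s x - word s y.
Proof. by rewrite wordD wordN. Qed.

Lemma word_hf s x y : hf (word s x) (word s y) = hf x y.
Proof. by elim: s => //= i s <-; rewrite hrefl_hf //; exact: asr_root. Qed.

Lemma word_root s x : real_root x -> real_root (word s x).
Proof.
by elim: s => //= i s IH /IH; apply: hrefl_root; exact: asr_root.
Qed.

Lemma word_delta s : word s dl = dl.
Proof. by elim: s => //= i s ->; apply: hrefl_delta; case: (asr_root i). Qed.

Lemma word_rcons s i x : word (rcons s i) x = word s (hrefl (asr i) x).
Proof. by elim: s => //= k s ->. Qed.

Lemma wordK s x : word (rev s) (word s x) = x.
Proof.
elim: s x => //= i s IH x; rewrite rev_cons word_rcons hreflK //; exact: asr_root.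
Qed.

Lemma wordKV s x : word s (word (rev s) x) = x.
Proof. by have := wordK (rev s) x; rewrite revK. Qed.

Lemma hrefl_conj s b x :
  hrefl b (word s x) = word s (hrefl (word (rev s) b) x).
Proof.
rewrite /hrefl /hat_coroot word_hf wordB !wordZ wordKV; congr (_ - _ *: _).
by rewrite -{1}(wordKV s b) word_hf.
Qed.

(** Exchange for words that need not be reduced: b is carried through the letters, and the letter
    that turns it negative is the reflection in a multiple of its image, so it cancels. *)
Lemma word_exchange s b : real_root b -> hpos b -> hpos (- word (rev s) b) ->
  exists2 s', (size s' < size s)%N & hrefl b \o word s = word s'.
Proof.
elim: s b => [|k s IH] b rb b0 bn; first by case: (hpos_not rb b0).
have kb : real_root (hrefl (asr k) b) by apply: hrefl_root => //; exact: asr_root.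
have conj x : hrefl b (hrefl (asr k) x) = hrefl (asr k) (hrefl (hrefl (asr k) b) x).
  by rewrite (hrefl_conj [:: k]).
case: (hpos_or kb) => [pos|/(hpos_flip rb b0) [bE c0]].
  rewrite rev_cons word_rcons in bn.
  have [s' lt e] := IH _ kb pos bn.
  exists (k :: s') => //=; apply/funext => x /=.
  by rewrite conj; have /= := congr1 (@^~ x) e => ->.
exists s => //; apply/funext => x /=.
by rewrite bE hrefl_scale // hreflK //; exact: asr_root.
Qed.

(* [invD w] is the set I such that the inversions of the form delta - x of w are
   those with x in I; [delta_only w] says that w has no other inversions. *)
Definition delta_only (w : hV -> hV) :=
  forall b, real_root b -> hpos b -> hpos (- w b) -> exists2 x, D x & b = dl - inV x.

Definition invD (w : hV -> hV) : set V := [set x | D x /\ hpos (- w (dl - inV x))].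

(** In a word k :: s the hypothesis at k says that [word (rev s)] makes alpha_k negative, so
    exchange rewrites the whole word as one shorter than its tail. *)
Lemma word_id s : (forall i, hpos (word (rev s) (asr i))) -> word s = id.
Proof.
have [N] := ubnP (size s); elim: N s => // N IH [|k s] // lt h.
have rk := asr_root k; have rb := word_root (rev s) rk.
have neg : hpos (- word (rev s) (asr k)).
  have := h k; rewrite rev_cons word_rcons.
  have -> : hrefl (asr k) (asr k) = - asr k.
    rewrite hreflE mulfK ?gt_eqF ?hf_root_gt0 //.
    by rewrite scaler_nat mulr2n opprD addNKr.
  by rewrite wordN.
have kpos : hpos (asr k) by move=> i; rewrite acoord_asr ler0n.
have [s' lt' e] := word_exchange rk kpos neg.
have {}e : word (k :: s) = word s' := e.
rewrite e; apply: IH; first by apply: leq_trans lt' (ltnW _).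
move=> i; by have := h i; rewrite -{1}(wordKV s' (asr i)) -e wordK.
Qed.

Lemma delta_pos : hpos dl.
Proof.
move=> i; case: (unliftP ord0 i) => [j ->|->]; last by rewrite acoord0.
by rewrite acoord_lift /= mxE add0r mul1r (le_trans ler01 (top_ge1 rsD j)).
Qed.

Lemma level0_root x : D x -> real_root (inV x).
Proof. by move=> Dx; split => //=; exact: rpred0. Qed.

Lemma level0_pos x : vle 0 x <-> hpos (inV x).
Proof.
split=> [/vle0P h i|h]; last first.
  by apply/vle0P => j; have := h (lift ord0 j); rewrite acoord_lift /= mul0r addr0.
case: (unliftP ord0 i) => [j ->|->]; last by rewrite acoord0.
by rewrite acoord_lift /= mul0r addr0.
Qed.

Lemma deltaB_root x (k : nat) : D x -> real_root (dl *+ k - inV x).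
Proof.
move=> Dx; split => /=.
- have -> : (dl *+ k).1.1 = 0 by elim: k => // k IH; rewrite mulrS /= IH addr0.
  by rewrite add0r; exact: (root_opp rsD Dx).
- have -> : ((dl *+ k).1.2 : R) = k%:R.
    by elim: k => // k IH; rewrite !mulrS /= IH.
  by rewrite oppr0 addr0 rpred_nat.
- have -> : (dl *+ k).2 = 0 by elim: k => // k IH; rewrite mulrS /= IH addr0.
  by rewrite oppr0 addr0.
Qed.


Lemma inVD x y : inV (x + y) = inV x + inV y :> hV.
Proof. by apply: hatV_eq; rewrite /= ?addr0. Qed.

Lemma inVZ c x : inV (c *: x) = c *: inV x :> hV.
Proof. by apply: hatV_eq; rewrite /= ?scaler0. Qed.

Lemma inVN x : inV (- x) = - inV x :> hV.
Proof. by apply: hatV_eq; rewrite /= ?oppr0. Qed.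

Lemma deltaB1_root x : D x -> real_root (dl - inV x).
Proof. exact: (@deltaB_root x 1). Qed.

Lemma deltaB1_level x : (dl - inV x).1.2 = 1 :> R.
Proof. by rewrite /= oppr0 addr0. Qed.

Lemma deltaB_pos x (k : nat) : D x -> (0 < k)%N -> hpos (dl *+ k - inV x).
Proof.
move=> Dx k0 i; have lev : (dl *+ k).1.2 = k%:R :> R.
  by elim: k {k0} => // k IH; rewrite !mulrS /= IH.
have k1 : 1 <= k%:R :> R by rewrite ler1n.
case: (unliftP ord0 i) => [j ->|->].
  have -> : acoord (lift ord0 j) (dl *+ k - inV x) = k%:R * theta 0 j - x 0 j.
    rewrite acoordB !acoord_lift lev /= mul0r addr0.
    suff -> : (dl *+ k).1.1 = 0 by rewrite mxE add0r.
    by elim: k {k0 k1 lev} => // k IH; rewrite mulrS /= IH addr0.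
  have := root_le_top rsD Dx j; have := top_ge1 rsD j; nra.
by rewrite acoord0 /= lev oppr0 addr0 (le_trans ler01).
Qed.

Lemma deltaB1_pos x : D x -> hpos (dl - inV x).
Proof. by move=> Dx; exact: (@deltaB_pos x 1). Qed.

(** * Building a minuscule element one root at a time *)

Definition astep s i v :=
  [/\ D v, delta_only (word s), delta_only (word (i :: s))
    & word s (dl - inV v) = asr i].

(** The positive root - w^-1 alpha_i is inverted by w, so [delta_only] gives it the form delta - v,
    and exchange shortens s_i w. *)
Lemma descent s i : delta_only (word s) -> hpos (- word (rev s) (asr i)) ->
  exists s' v, [/\ (size s' < size s)%N, astep s' i v & word s = word (i :: s')].
Proof.
move=> ds neg; have ri := asr_root i.
have ipos : hpos (asr i) by move=> k; rewrite acoord_asr ler0n.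
have wn : word s (- word (rev s) (asr i)) = - asr i by rewrite wordN wordKV.
have [|v Dv vE] := ds _ (real_rootN (word_root (rev s) ri)) neg.
  by rewrite wn opprK.
have [s' lt e] := word_exchange ri ipos neg.
have sE : word s = word (i :: s').
  by apply/funext => x; rewrite /= -e /= hreflK.
have s'v : word s' (dl - inV v) = asr i.
  rewrite -e /= -vE wn.
  rewrite hreflE hfNl mulrN mulNr scaleNr opprK mulfK ?gt_eqF ?hf_root_gt0 //.
  by rewrite scaler_nat mulr2n addKr.
exists s', v; split=> //; split => // [b rb b0 bn|]; last by rewrite -sE.
have rsb := word_root s rb.
(* A root inverted by s' but not by s would be - c (delta - v) with c > 0, against its nonnegative
   level. *)
case: (hpos_or rsb) => [pos|]; last exact: ds.
have s'b : hpos (- hrefl (asr i) (word s b)) by have /= -> := congr1 (@^~ b) e.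
have [cE c0] := hpos_flip rsb pos s'b.
have c1 : 0 <= acoord i (word s b) by exact: pos.
set c := acoord i _ in cE c0 c1.
have bE : b = - c *: (dl - inV v).
  by rewrite -(wordK s b) cE wordZ -vE scalerN scaleNr opprK.
have := b0 ord0; rewrite bE acoordZ acoord0 deltaB1_level mulr1 oppr_ge0 => c2.
by case/eqP: c0; apply/eqP; rewrite eq_le c2.
Qed.

(** Letters are peeled off until no w^-1 alpha_i is negative, where [word_id] applies. [P] is a
    property of the map because exchange replaces the word. *)
Lemma chain_ind (P : (hV -> hV) -> Prop) : P id ->
  (forall s i v, astep s i v -> P (word s) -> P (word (i :: s))) ->
  forall s, delta_only (word s) -> P (word s).
Proof.
move=> P0 PS s; have [N] := ubnP (size s); elim: N s => // N IH s lt ds.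
case: (pselect (exists i, hpos (- word (rev s) (asr i)))) => [[i neg]|no].
  have [s' [v [lt' st ->]]] := descent ds neg.
  apply: (PS _ _ _ st); apply: IH; first exact: leq_trans lt' _.
  by case: st.
rewrite word_id // => i; case: (hpos_or (word_root (rev s) (asr_root i))) => //.
by move=> neg; case: no; exists i.
Qed.

Lemma astepE s i v x : astep s i v ->
  word (i :: s) (inV x) = word s (inV x) + pr x v *: asr i.
Proof.
case=> Dv _ _ e; rewrite [LHS]hreflE -scaleNr; congr (_ + _ *: _).
rewrite -e !word_hf !hf_level0 /= ?oppr0 ?addr0 // /pairing.
by rewrite add0r !ipE opprK mulrN mulNr opprK.
Qed.

(** The reflection changes the sign only of multiples of alpha_i, so only multiples of delta - v are
    affected; all roots compared have level 1, which leaves v alone. *)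
Lemma invD_astep s i v x : astep s i v ->
  invD (word (i :: s)) x <-> invD (word s) x \/ x = v.
Proof.
move=> [Dv ds dis e]; have ri := asr_root i; split.
  move=> [Dx neg]; have rb := word_root s (deltaB1_root Dx).
  case: (hpos_or rb) => [pos|]; last by left.
  have [cE c0] := hpos_flip rb pos neg; right.
  set c := acoord i _ in cE c0.
  have xE : dl - inV x = c *: (dl - inV v).
    by rewrite -(wordK s (dl - inV x)) cE wordZ -e wordK.
  have c1 : 1 = c.
    have := congr1 (fun y : hV => y.1.2 : R) xE; rewrite deltaB1_level => ->.
    by rewrite -[LHS]/(c * (dl - inV v).1.2) deltaB1_level mulr1.
  by move: xE; rewrite -c1 scale1r => /addrI/oppr_inj/(congr1 (fun y : hV => y.1.1)).
case=> [[Dx neg]|->]; last first.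
  split=> //; have -> : word (i :: s) (dl - inV v) = hrefl (asr i) (asr i).
    by rewrite -{2}e.
  rewrite hreflE mulfK ?gt_eqF ?hf_root_gt0 // scaler_nat mulr2n opprB addrK.
  by move=> k; rewrite acoord_asr ler0n.
split=> //; set b := - word s (dl - inV x) in neg.
have rb : real_root b by apply/real_rootN/word_root/deltaB1_root.
have -> : - word (i :: s) (dl - inV x) = hrefl (asr i) b.
  by rewrite /b -scaleN1r -[in RHS]scaleN1r hreflZ.
have rib := hrefl_root ri rb.
case: (hpos_or rib) => // neg'.
have [cE c0] := hpos_flip rb neg neg'.
set c := acoord i _ in cE c0.
have xE : dl - inV x = - c *: (dl - inV v).
  rewrite -(wordK s (dl - inV x)) -[word s (dl - _)]opprK -/b cE wordN wordZ.
  by rewrite -e wordK scaleNr.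
have c1 : 1 = - c.
  have := congr1 (fun y : hV => y.1.2 : R) xE; rewrite deltaB1_level => ->.
  by rewrite -[LHS]/(- c * (dl - inV v).1.2) deltaB1_level mulr1.
have c2 : 0 <= c by exact: neg.
by move: c2; rewrite -oppr_le0 -c1 ler10.
Qed.

(** Simple roots of V have level 0 and so are not inverted; linearity extends this to every
    nonnegative vector, root or not. *)
Lemma word_pos s v : delta_only (word s) -> vle 0 v -> hpos (word s (inV v)).
Proof.
move=> ds /vle0P v0 i.
have sp j : 0 <= acoord i (word s (inV (al j))).
  have rj := level0_root (root_simple rsD j).
  have jp : hpos (inV (al j)) by apply/level0_pos/vle0P => k; rewrite simpleE ler0n.
  case: (hpos_or (word_root s rj)) => [|neg]; first exact.
  have [y _ /(congr1 (fun y : hV => y.1.2 : R))] := ds _ rj jp neg.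
  by rewrite deltaB1_level /= => /eqP; rewrite eq_sym oner_eq0.
pose f x := acoord i (word s (inV x)).
have fD x y : f (x + y) = f x + f y by rewrite /f inVD wordD acoordD.
have fZ c x : f (c *: x) = c * f x by rewrite /f inVZ wordZ acoordZ.
have f0 : f 0 = 0 by rewrite -(scale0r (0 : V)) fZ mul0r.
rewrite -/(f v) [v]row_sum_delta (big_morph f fD f0).
by apply: sumr_ge0 => j _; rewrite fZ mulr_ge0 // sp.
Qed.

(** Write delta - y = (delta - x) - (y - x); [word_pos] covers y - x, which need not be a root. *)
Lemma invD_up s x y : delta_only (word s) -> invD (word s) x -> D y ->
  vle x y -> invD (word s) y.
Proof.
move=> ds [Dx neg] Dy xy; split=> // i.
have -> : dl - inV y = (dl - inV x) - inV (y - x).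
  by rewrite inVD inVN opprB addrA subrK.
rewrite wordB opprB acoordB -[acoord i (word s (dl - _))]opprK -acoordN opprK.
apply: addr_ge0; last exact: neg.
by apply: word_pos => //; apply/vle0P => k; rewrite !mxE subr_ge0.
Qed.

Lemma invD_vle0 s x : delta_only (word s) -> invD (word s) x -> vle 0 x.
Proof.
move=> ds [Dx neg]; case: (root_vle rsD Dx) => // xn.
case: (hpos_not (word_root s (deltaB1_root Dx))) => // i.
rewrite -inVN wordD acoordD word_delta addr_ge0 //; first exact: delta_pos.
exact: word_pos.
Qed.

(** Otherwise 2 delta - (x + y) would be an inverted root of level 2. *)
Lemma invD_abelian s x y : delta_only (word s) ->
  invD (word s) x -> invD (word s) y -> D (x + y) -> False.
Proof.
move=> ds [Dx nx] [Dy ny] Dxy.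
have r2 := @deltaB_root (x + y) 2 Dxy.
have [|z _] := ds _ r2 (deltaB_pos Dxy (ltn0Sn 1)).
  move=> i; rewrite (_ : _ - _ = (dl - inV x) + (dl - inV y)).
    by rewrite wordD opprD acoordD addr_ge0.
  by rewrite inVD mulr2n opprD addrACA.
move=> /(congr1 (fun y : hV => y.1.2 : R)); rewrite deltaB1_level /= oppr0 addr0 => /eqP.
by rewrite -subr_eq0 addrK oner_eq0.
Qed.


Lemma invD_id x : ~ invD id x.
Proof.
move=> [Dx neg]; exact: hpos_not (deltaB1_root Dx) (deltaB1_pos Dx) neg.
Qed.

Lemma acoord_astep s i v j x : astep s i v ->
  acoord (lift ord0 j) (word (i :: s) (inV x)) =
  acoord (lift ord0 j) (word s (inV x)) + pr x v * (i == lift ord0 j)%:R.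
Proof. by move=> st; rewrite (astepE _ st) acoordD acoordZ acoord_asr. Qed.

Lemma acoord_inV j x : acoord (lift ord0 j) (inV x) = x 0 j.
Proof. by rewrite acoord_lift /= mul0r addr0. Qed.

(* For the positive root g first entering the set of w through w (delta - g) =
   alpha_i, the first bound is nearly an equality at g; this yields the second. *)
Lemma top_coord_bounds s : delta_only (word s) -> forall g, D g -> 0 < ip g theta ->
  forall j,
  (~ invD (word s) g ->
    acoord (lift ord0 j) (word s (inV g)) - g 0 j <=
    acoord (lift ord0 j) (word s (inV theta)) - theta 0 j) /\
  (invD (word s) g ->
    2 * theta 0 j - g 0 j <= acoord (lift ord0 j) (word s (inV theta))).
Proof.
move: s; pose P w := forall g, D g -> 0 < ip g theta -> forall j,
  (~ invD w g -> acoord (lift ord0 j) (w (inV g)) - g 0 j <=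
    acoord (lift ord0 j) (w (inV theta)) - theta 0 j) /\
  (invD w g -> 2 * theta 0 j - g 0 j <= acoord (lift ord0 j) (w (inV theta))).
apply: (@chain_ind P) => [g Dg gt j|s i v st IH g Dg gt j].
  by split=> [_|/invD_id //]; rewrite !acoord_inV !subrr.
have [Dv ds dis e] := st; have vI : invD (word (i :: s)) v by apply/(invD_astep _ st); right.
have v0 := invD_vle0 dis vI.
have tv : 0 <= pr theta v.
  by rewrite leNgt (pairing_lt0 rsD _ Dv) -leNgt; exact: (top_pos_ge0 rsD v0).
have b0 : 0 <= (i == lift ord0 j)%:R :> R by rewrite ler0n.
rewrite !(acoord_astep _ _ st); split=> [ng|].
  have [/(_ _) IH1 _] := IH _ Dg gt j.
  have {}IH1 := IH1 (fun h => ng (proj2 (invD_astep g st) (or_introl h))).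
  suff : pr g v <= pr theta v by nra.
  case: (lerP (pr g v) 0) => [h|]; first exact: le_trans tv.
  rewrite (pairing_gt0 rsD _ Dv) => gv.
  have gnv : g <> v by move=> gE; apply: ng; rewrite gE.
  have [vt|vt] := lerP (ip v theta) 0; last exact: (pairing_le_top rsD).
  (* If v is not acute with theta, then g - v is a root acute with theta, hence positive, and g
     would belong to the set together with v. *)
  case: ng; apply: (invD_up dis vI Dg) => k; rewrite -subr_ge0.
  have Dgv := root_sub rsD Dg Dv gv gnv.
  have : vle 0 (g - v) by apply: (top_gt0_pos rsD Dgv); rewrite !ipE; lra.
  by move=> /(_ k); rewrite !mxE.
move=> /(invD_astep _ st) [gI|gE].
  by have [_ /(_ gI)] := IH _ Dg gt j; nra.
have nI : ~ invD (word s) g.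
  rewrite gE => -[_]; rewrite e => neg.
  apply: (hpos_not (asr_root i) _ neg) => k; by rewrite acoord_asr ler0n.
have [/(_ nI) IH1 _] := IH _ Dg gt j.
have wg : acoord (lift ord0 j) (word s (inV g)) = theta 0 j - (i == lift ord0 j)%:R.
  have -> : inV g = dl - (dl - inV v) :> hV by rewrite gE opprB addrC subrK.
  rewrite wordB word_delta e acoordB acoord_asr; congr (_ - _).
  by rewrite acoord_lift /= mxE add0r mul1r.
(* This pairing makes up for the unit lost in [wg]. *)
have tg1 : 1 <= pr theta v.
  apply: int_gt0_ge1; first exact: (root_int rsD Dv (root_top rsD)).
  by rewrite (pairing_gt0 rsD _ Dv) -gE (ipC rsD).
rewrite wg in IH1; nra.
Qed.

Lemma hpos_linear_ge0 (F : hV -> R) (y : hV) :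
  (forall u v, F (u + v) = F u + F v) -> (forall c u, F (c *: u) = c * F u) ->
  y.2 = 0 -> hpos y -> (forall i, 0 <= F (asr i)) -> 0 <= F y.
Proof.
move=> FD FZ y2 y0 F0; rewrite (acoord_decomp y2) FD FZ addr_ge0 //.
  by rewrite mulr_ge0.
pose f x := F (inV x).
have fD u v : f (u + v) = f u + f v by rewrite /f inVD FD.
have fz : f 0 = 0.
  by rewrite /f -(scale0r (0 : V)) inVZ FZ mul0r.
rewrite -/(f _) [\row_j _]row_sum_delta (big_morph f fD fz).
apply: sumr_ge0 => j _; rewrite /f inVZ FZ mulr_ge0 //; first by rewrite mxE.
by rewrite -asr_lift.
Qed.

(* Elements of the set orthogonal to theta can be removed: pairing with theta and
   adding the level is negative at gamma - delta for such gamma only. *)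
Lemma remove_perp s e : delta_only (word s) -> invD (word s) theta ->
  invD (word s) e -> ip e theta = 0 ->
  exists s' i v, [/\ (size s' < size s)%N, astep s' i v, word s = word (i :: s')
                   & ip v theta = 0].
Proof.
move=> ds tI eI et; have [De neg] := eI; have Dt := root_top rsD.
pose f (x : hV) : R := pr x.1.1 theta + x.1.2.
have fD x y : f (x + y) = f x + f y by rewrite /f /= (pairingDl rsD); ring.
have fZ c x : f (c *: x) = c * f x.
  by rewrite /f /pairing /= (ipZl rsD) -[c *: x.1.2]/(c * x.1.2); ring.
have fN x : f (- x) = - f x by rewrite -scaleN1r fZ mulN1r.
have [i fi] : exists i, f (word (rev s) (asr i)) < 0.
  apply: contrapT => /forallNP no.
  have : 0 <= f (word (rev s) (- word s (dl - inV e))).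
    apply: (@hpos_linear_ge0 (fun x => f (word (rev s) x))) => //.
    - by move=> x y; rewrite wordD fD.
    - by move=> c x; rewrite wordZ fZ.
    - have [_ _ ->] // := real_rootN (word_root s (deltaB1_root De)).
    - by move=> i; rewrite leNgt; apply/negP/no.
  rewrite wordN wordK fN /f deltaB1_level /pairing /= add0r (ipNl rsD) et.
  by rewrite oppr0 mulr0 mul0r add0r oppr_ge0 ler10.
set b := word (rev s) (asr i) in fi.
have rb : real_root b := word_root (rev s) (asr_root i).
have ipos : hpos (asr i) by move=> k; rewrite acoord_asr ler0n.
case: (hpos_or rb) => [bpos|bneg].
  (* The only positive real root with [f] negative is delta - theta: at level 0 dominance of theta
     forbids it, and at level at least 1 the pairing with theta must be below -1. But theta lies in
     the set, so w inverts delta - theta. *)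
  have [Db bI b2] := rb; exfalso.
  have l0 : 0 <= (b.1.2 : R) by rewrite -acoord0.
  have bE : b.1.1 = - theta /\ b.1.2 = 1 :> R.
    have [l00|l00] := eqVneq (b.1.2 : R) 0.
      have : vle 0 b.1.1.
        apply/vle0P => j; have := bpos (lift ord0 j).
        by rewrite acoord_lift l00 mul0r addr0.
      move=> /(top_pos_ge0 rsD); rewrite (ipC rsD) => h.
      move: fi; rewrite /f l00 addr0 (pairing_lt0 rsD _ Dt); lra.
    have l1 : 1 <= (b.1.2 : R) by apply: int_gt0_ge1; rewrite // lt_neqAle eq_sym l00.
    have [bt|/eqP bt] := eqVneq b.1.1 theta.
      by move: fi; rewrite /f bt (pairing_self rsD Dt); lra.
    have [bt'|/eqP bt'] := eqVneq b.1.1 (- theta); last first.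
      by have /andP[] := pairing_top rsD Db bt bt'; move: fi; rewrite /f; lra.
    split=> //; move: fi; rewrite /f bt' (pairingNl rsD) (pairing_self rsD Dt) => fi.
    apply/eqP; rewrite eq_le l1 andbT.
    by apply: int_lt2_le1 => //; lra.
  have {bE}bE : b = dl - inV theta.
    case: bE => e1 e2; apply: hatV_eq; rewrite /= ?e1 ?e2 ?b2 ?oppr0 ?addr0 ?add0r //.
  have [_] := tI; rewrite -bE wordKV => ineg.
  exact: hpos_not (asr_root i) ipos ineg.
have [s' [v [lt st sE]]] := descent ds bneg.
exists s', i, v; split => //.
have [Dv ds' dis e'] := st.
have vI : invD (word s) v by rewrite sE; apply/(invD_astep _ st); right.
have bv : dl - inV v = - b.
  apply: (can_inj (wordK s)); rewrite wordN wordKV sE.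
  have -> : word (i :: s') (dl - inV v) = hrefl (asr i) (asr i) by rewrite -{2}e'.
  rewrite hreflE mulfK ?gt_eqF ?hf_root_gt0 //; last exact: asr_root.
  by rewrite scaler_nat mulr2n opprD addNKr.
(* Since b = - (delta - v), the sign of [f b] says <v, theta^v> < 1. *)
apply/eqP; rewrite eq_le; apply/andP; split; last first.
  by rewrite (ipC rsD); exact: (top_pos_ge0 rsD (invD_vle0 ds vI)).
rewrite leNgt -(pairing_gt0 rsD _ Dt); apply/negP => /(int_gt0_ge1 (root_int rsD Dt Dv)).
move: fi; rewrite -[b]opprK -bv fN /f deltaB1_level /= add0r (pairingNl rsD); lra.
Qed.

(** Deleting a root v orthogonal to theta changes w theta by the multiple <theta, v^v> = 0 of a
    simple root, so the rootlet survives. *)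
Lemma restrict_top s : delta_only (word s) -> invD (word s) theta ->
  exists s', [/\ delta_only (word s'), word s' (inV theta) = word s (inV theta)
    & forall x, invD (word s') x <-> invD (word s) x /\ 0 < ip x theta].
Proof.
have [N] := ubnP (size s); elim: N s => // N IH s lt ds tI; have Dt := root_top rsD.
have ge0 x : invD (word s) x -> 0 <= ip x theta.
  by move=> xI; rewrite (ipC rsD); exact: (top_pos_ge0 rsD (invD_vle0 ds xI)).
case: (pselect (exists2 e, invD (word s) e & ip e theta = 0)) => [[e eI et]|no].
  have [s' [i [v [lt' st sE vt]]]] := remove_perp ds tI eI et.
  have [Dv ds' dis _] := st.
  have tv : theta <> v.
    by move=> tE; have := ip_root_gt0 rsD Dt; rewrite {1}tE vt ltxx.
  have tI' : invD (word s') theta.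
    by move: tI; rewrite sE => /(invD_astep _ st) [].
  have [s'' [ds'' e1 e2]] := IH s' (leq_trans lt' lt) ds' tI'.
  exists s''; split=> //.
    rewrite e1 sE (astepE _ st) /pairing (ipC rsD) vt mulr0 mul0r scale0r addr0 //.
  move=> x; rewrite e2 sE; split=> -[h1 h2]; split=> //.
    by apply/(invD_astep _ st); left.
  by case/(invD_astep _ st): h1 => // xv; move: h2; rewrite xv vt ltxx.
exists s; split=> // x; split=> [xI|[]//]; split=> //.
rewrite lt_neqAle ge0 // andbT eq_sym; apply/eqP => xt; apply: no; by exists x.
Qed.


Lemma invD_empty s : delta_only (word s) -> (forall x, ~ invD (word s) x) ->
  word s = id.
Proof.
move=> ds; suff : word s = id \/ exists x, invD (word s) x.
  by case=> // -[x xI] /(_ x).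
move: s ds; pose P (w : hV -> hV) := w = id \/ exists x, invD w x.
apply: (@chain_ind P) => [|s i v st _]; first by left.
by right; exists v; apply/(invD_astep _ st); right.
Qed.

(** Only s_0 changes the level, and it occurs once, at the first step, where v = theta. At a later
    occurrence w_0 v = theta, so (theta, w_0 (2 delta - theta)) = - (v, theta) < 0, although w_0 (2
    delta - theta) is a positive root of level 0. *)
Lemma word_level_top s : delta_only (word s) ->
  (forall x, invD (word s) x -> 0 < ip x theta) -> (exists x, invD (word s) x) ->
  forall y, (word s (inV y)).1.2 = pr y theta :> R.
Proof.
have Dt := root_top rsD.
move: s; pose P w := (forall x, invD w x -> 0 < ip x theta) ->
  (exists x, invD w x) -> forall y, (w (inV y)).1.2 = pr y theta :> R.
apply: (@chain_ind P) => [_ [x /invD_id]//|s i v st IH pos _ y].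
have [Dv ds dis e] := st; have vI : invD (word (i :: s)) v by apply/(invD_astep _ st); right.
have lev x : (word (i :: s) (inV x)).1.2 =
    (word s (inV x)).1.2 + pr x v * (i == ord0)%:R :> R.
  by rewrite -!acoord0 (astepE _ st) acoordD acoordZ acoord_asr.
have vt : 0 < ip v theta by exact: pos.
case: (pselect (exists x, invD (word s) x)) => [ne|no]; last first.
  have wid : word s = id by apply: invD_empty => // x xI; apply: no; exists x.
  rewrite lev wid /= add0r; move: e; rewrite wid /= => e.
  have i0 : i = ord0.
    case: (unliftP ord0 i) => [j ij|//]; have := acoord_asr i ord0.
    rewrite -e acoord0 deltaB1_level ij => /eqP.
    by rewrite -[_ == ord0]/false oner_eq0.
  rewrite i0 eqxx mulr1; congr (pr _ _).
  by move: e; rewrite i0 asr0 => /addrI/oppr_inj/(congr1 (fun y : hV => y.1.1)).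
have pos' x : invD (word s) x -> 0 < ip x theta.
  by move=> xI; apply: pos; apply/(invD_astep _ st); left.
have {}IH := IH pos' ne.
have tI : invD (word s) theta.
  by case: ne => x xI; apply: (invD_up ds xI Dt); apply: (root_le_top rsD); case: xI.
rewrite lev IH; suff -> : i == ord0 = false by rewrite mulr0 addr0.
apply/negP => /eqP i0.
have wv : word s (inV v) = inV theta.
  have -> : inV v = dl - (dl - inV v) :> hV by rewrite opprB addrC subrK.
  by rewrite wordB word_delta e i0 asr0 opprB addrC subrK.
set m := dl *+ 2 - inV theta.
have rm : real_root m by exact: deltaB_root.
have mpos : hpos (word s m).
  case: (hpos_or (word_root s rm)) => // neg.
  have [z _] := ds _ rm (deltaB_pos Dt (ltn0Sn 1)) neg.
  move=> /(congr1 (fun y : hV => y.1.2 : R)); rewrite deltaB1_level /= oppr0 addr0 => /eqP.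
  by rewrite -subr_eq0 addrK oner_eq0.
have mlev : (word s m).1.2 = 0 :> R.
  have -> : word s m = dl + dl - word s (inV theta).
    by rewrite wordB mulr2n wordD word_delta.
  by rewrite /= IH (pairing_self rsD Dt); exact: subrr.
have m0 : vle 0 (word s m).1.1.
  apply/vle0P => j; have := mpos (lift ord0 j).
  by rewrite acoord_lift mlev mul0r addr0.
have [_ _ m2] := word_root s rm.
have := top_pos_ge0 rsD m0.
have -> : ip theta (word s m).1.1 = hf (inV theta) (word s m) by rewrite hf_level0.
rewrite -wv word_hf /m hf_level0 /= ?oppr0 ?addr0 // add0r (ipNr rsD); lra.
Qed.

(** [pairing_perp_le] summed over the steps in the reflection of alpha_j; there |v| = |alpha_j|,
    because delta - v is carried to alpha_j. *)
Lemma perp_coord_bound s : delta_only (word s) ->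
  (forall x, invD (word s) x -> 0 < ip x theta) ->
  forall g j, D g -> ip g theta = 0 -> ip (al j) (al j) <= ip g g ->
  ip theta theta * `|acoord (lift ord0 j) (word s (inV g)) - g 0 j| <=
  ip g g * (acoord (lift ord0 j) (word s (inV theta)) - theta 0 j).
Proof.
move: s; pose P w := (forall x, invD w x -> 0 < ip x theta) ->
  forall g j, D g -> ip g theta = 0 -> ip (al j) (al j) <= ip g g ->
  ip theta theta * `|acoord (lift ord0 j) (w (inV g)) - g 0 j| <=
  ip g g * (acoord (lift ord0 j) (w (inV theta)) - theta 0 j).
apply: (@chain_ind P) => [_ g j _ _ _|s i v st IH pos g j Dg gt gj].
  by rewrite !acoord_inV !subrr normr0 !mulr0.
have [Dv ds dis e] := st; have vI : invD (word (i :: s)) v by apply/(invD_astep _ st); right.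
have vt : 0 < ip v theta by exact: pos.
have pos' x : invD (word s) x -> 0 < ip x theta.
  by move=> xI; apply: pos; apply/(invD_astep _ st); left.
have {}IH := IH pos' g j Dg gt gj.
rewrite !(acoord_astep _ _ st); case: eqP => [ij|_]; last by rewrite !mulr0 !addr0.
rewrite !mulr1 !(addrAC _ (pr _ _)) mulrDr.
have vg : ip v v <= ip g g.
  suff -> : ip v v = ip (al j) (al j) by [].
  have := word_hf s (dl - inV v) (dl - inV v); rewrite e ij asr_lift.
  by rewrite !hf_level0 /= ?oppr0 ?addr0 // add0r (ipNl rsD) (ipNr rsD) opprK.
have := pairing_perp_le rsD Dg Dv vt gt vg.
set a := _ - g 0 j in IH *; set b := _ - theta 0 j in IH *.
have t0 := ip_ge0 rsD theta.
have := ler_wpM2l t0 (ler_normD a (pr g v)); rewrite mulrDr; lra.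
Qed.

(** * The rootlet lies below every root of the ideal *)

Section Rootlet.
Context (s : seq 'I_n.+1) (mu : V).
Hypotheses (ds : delta_only (word s)) (Dmu : D mu).
Hypothesis rootlet_mu : word s (dl *+ 2 - inV theta) = inV mu.

Let Dt := root_top rsD.

Lemma word_top : word s (inV theta) = dl + dl - inV mu.
Proof.
rewrite -rootlet_mu wordB mulr2n wordD word_delta opprB addrC.
by rewrite subrK.
Qed.

Lemma rootlet_norm : ip mu mu = ip theta theta.
Proof.
have -> : ip mu mu = hf (inV mu) (inV mu) by rewrite hf_level0.
rewrite -rootlet_mu word_hf hf_level0 /= ?oppr0 ?addr0 //.
by rewrite add0r (ipNl rsD) (ipNr rsD) opprK.
Qed.

(** A root of level 2, such as 2 delta - theta, is never inverted. *)
Lemma rootlet_pos : vle 0 mu.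
Proof.
have rm := @deltaB_root theta 2 Dt.
apply/level0_pos; rewrite -rootlet_mu.
case: (hpos_or (word_root s rm)) => // neg.
have [z _] := ds rm (deltaB_pos Dt (ltn0Sn 1)) neg.
move=> /(congr1 (fun y : hV => y.1.2 : R)); rewrite deltaB1_level /= oppr0 addr0 => /eqP.
by rewrite -subr_eq0 addrK oner_eq0.
Qed.

Lemma acoord_top j : acoord (lift ord0 j) (word s (inV theta)) = 2 * theta 0 j - mu 0 j.
Proof.
rewrite word_top acoordB acoordD acoord_inV acoord_lift /= mxE add0r mul1r.
by ring.
Qed.

Lemma rootlet_le_acute g : invD (word s) g -> 0 < ip g theta -> vle mu g.
Proof.
move=> gI gt j; have [Dg _] := gI.
have [_ /(_ gI)] := top_coord_bounds ds Dg gt j.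
by rewrite acoord_top; lra.
Qed.

(** Let u be [word s']. The level formula puts u g in V. For the last clause write u^-1 z = k + l
    delta: then (k, theta) = - (z, mu) is nonzero, so l = - <k, theta^v> is 1 or -1. Accordingly k +
    theta or k is in the set of u, and its inversion reads z - mu >= 0 or z >= 0. *)
Lemma perp_image_pos s' g : delta_only (word s') ->
  word s' (inV theta) = dl + dl - inV mu ->
  (forall x, invD (word s') x <-> invD (word s) x /\ 0 < ip x theta) ->
  invD (word s) g -> ip g theta = 0 ->
  exists g', [/\ word s' (inV g) = inV g', D g', vle 0 g'
    & forall z, D z -> 0 < ip z g' -> ip z mu <> 0 -> vle 0 z].
Proof.
move=> ds' wt sub gI gt; have [Dg _] := gI; have g0 := invD_vle0 ds gI.
have gth : vle g theta by exact: root_le_top rsD _ Dg.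
have tI : invD (word s') theta.
  apply/sub; split; last exact: ip_root_gt0 rsD _ Dt.
  exact: invD_up ds gI Dt gth.
have lev y : (word s' (inV y)).1.2 = pr y theta :> R.
  by apply: word_level_top => // [x /sub[]//|]; exists theta.
have rg := level0_root Dg; have [Dg' _ g'2] := word_root s' rg.
set g' := (word s' (inV g)).1.1 in Dg'.
have gE : word s' (inV g) = inV g'.
  by apply: hatV_eq => //=; rewrite lev /pairing gt mulr0 mul0r.
exists g'; split=> //.
  by apply/level0_pos; rewrite -gE; exact: word_pos.
(* A root acute with both theta and g lies above g, since its difference from g is a root still
   acute with theta. *)
have key k : D k -> 0 < ip k theta -> 0 < ip k g -> hpos (- word s' (dl - inV k)).
  move=> Dk kt kg; suff /sub[_ h] : invD (word s) k /\ 0 < ip k theta by exact: h.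
  split=> //; apply: (invD_up ds gI Dk).
  have ne : k <> g by move=> e; move: kt; rewrite e gt ltxx.
  have Dkg := root_sub rsD Dk Dg kg ne.
  have : vle 0 (k - g) by apply: (top_gt0_pos rsD Dkg); rewrite !ipE gt subr0.
  by move=> h j; have := h j; rewrite !mxE subr_ge0.
move=> z Dz zg zm.
have rz := level0_root Dz; have [Dk kI k2] := word_root (rev s') rz.
set kk := word (rev s') (inV z) in Dk kI k2; set k := kk.1.1 in Dk; set l : R := kk.1.2.
have kE : kk = inV k + l *: dl.
  apply: hatV_eq => /=.
  - by rewrite scaler0 addr0.
  - by rewrite add0r; exact: esym (mulr1 _).
  - by rewrite scaler0 addr0.
have wk : word s' kk = inV z by rewrite /kk wordKV.
have kg : ip k g = ip z g'.
  by rewrite -[LHS](@hf_level0 kk (inV g)) // -(word_hf s') wk gE hf_level0.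
have kt : ip k theta = - ip z mu.
  rewrite -[LHS](@hf_level0 kk (inV theta)) // -(word_hf s') wk wt hf_level0 //=; last first.
    by rewrite oppr0 !addr0.
  by rewrite !add0r (ipNr rsD).
have kl : l = - pr k theta.
  have := lev k; have -> : inV k = kk - l *: dl by rewrite kE addrK.
  rewrite wordB wordZ word_delta wk /= => <-.
  by rewrite -[l *: 1]/(l * 1) mulr1 add0r opprK.
have g_neq : forall x, ip x g <> 0 -> x <> theta /\ x <> - theta.
  by move=> x xg; split=> xE; apply: xg; rewrite xE ?(ipNl rsD) (ipC rsD) gt ?oppr0.
have [n1 n2] : k <> theta /\ k <> - theta.
  by apply: g_neq; rewrite kg => e; move: zg; rewrite e ltxx.
have /andP[p1 p2] := pairing_top rsD Dk n1 n2.
have pI : pr k theta \is a Num.int by exact: (root_int rsD Dt).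
have [kt0|kt0|kt0] := ltgtP (ip k theta) 0; last by case: zm; lra.
- have p0 : pr k theta < 0 by rewrite (pairing_lt0 rsD _ Dt).
  have pE : pr k theta = -1.
    have : 1 <= - pr k theta by apply: int_gt0_ge1; rewrite ?rpredN ?oppr_gt0.
    lra.
  have Dkt : D (k + theta).
    by have := root_refl rsD Dt Dk; rewrite pE scaleN1r opprK.
  have kt1 : 0 < ip (k + theta) theta.
    have := pairingE rsD k Dt; rewrite pE (ipDl rsD) mulN1r.
    have := ip_root_gt0 rsD Dt; lra.
  have kg1 : 0 < ip (k + theta) g by rewrite (ipDl rsD) (ipC rsD theta) gt addr0 kg.
  have hp := key _ Dkt kt1 kg1.
  have e : - word s' (dl - inV (k + theta)) = inV (z - mu).
    have -> : dl - inV (k + theta) = (dl + dl) - kk - inV theta.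
      by rewrite kE kl pE opprK scale1r inVD !opprD !addrA; congr (_ - _); rewrite addrAC addrK.
    rewrite wordB [word s' (_ - kk)]wordB wordD word_delta wk wt inVD inVN.
    by rewrite opprB addrC opprB addrA subrK.
  have /vle0P zm0 : vle 0 (z - mu) by apply/level0_pos; rewrite -e.
  have /vle0P m0 := rootlet_pos.
  by apply/vle0P => j; have := zm0 j; have := m0 j; rewrite !mxE; lra.
have p0 : 0 < pr k theta by rewrite (pairing_gt0 rsD _ Dt).
have pE : pr k theta = 1 by have := int_gt0_ge1 pI p0; lra.
have kg1 : 0 < ip k g by rewrite kg.
have hp := key _ Dk kt0 kg1.
apply/level0_pos; rewrite -wk -[kk]opprK wordN.
by have -> : - kk = dl - inV k by rewrite kE kl pE scaleN1r opprB.
Qed.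

Theorem rootlet_le g : invD (word s) g -> vle mu g.
Proof.
move=> gI0; have Dg0 := proj1 gI0; have g00 := invD_vle0 ds gI0.
move: g Dg0 g00 gI0; apply: (root_ind_up rsD) => g Dg g0 IH gI.
have [gt|gt0] := ltP 0 (ip g theta); first exact: rootlet_le_acute.
have {gt0}gt : ip g theta = 0.
  by apply/eqP; rewrite eq_le gt0 (ipC rsD) (top_pos_ge0 rsD g0).
move=> j; rewrite leNgt; apply/negP => gj.
have Da k := root_simple rsD k.
have up i : ip g (al i) < 0 -> invD (word s) (g + al i) /\ vle mu (g + al i).
  move=> gi; have ne : g <> - al i.
    move=> e; have /vle0P/(_ i) := g0; rewrite e coordN simple_diag; lra.
  have Dgi := root_add rsD Dg (Da i) gi ne.
  have gi0 : vle g (g + al i).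
    by move=> k; rewrite mxE lerDl simpleE ler0n.
  have giI := invD_up ds gI Dgi gi0.
  split=> //; apply: IH => //; first exact: invD_vle0 giI.
  rewrite /ht; under [ltRHS]eq_bigr do rewrite mxE; rewrite big_split /= ltrDl.
  rewrite (bigD1 i) //= simple_diag big1 ?addr0 ?ltr01 // => k ki.
  by rewrite simple_off // eq_sym.
(* Adding alpha_i with i different from j leaves the failing coordinate unchanged, against the
   induction hypothesis. *)
have acute i : i != j -> 0 <= ip g (al i).
  move=> ij; rewrite leNgt; apply/negP => /up[_ /(_ j)].
  by rewrite mxE simple_off // addr0 leNgt gj.
have [gaj gj0] := perp_obstruction rsD Dg g0 gt acute.
have [gjI mle] := up j gaj.
have /vle0P m0 := rootlet_pos.
have mj : mu 0 j = 1.
  have h1 := mle j; have h2 := int_gt0_ge1 (root_coord_int rsD j Dmu).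
  move: h1; rewrite mxE simple_diag gj0 add0r => h1.
  by apply/eqP; rewrite eq_le h1 h2 // -gj0.
have aj0 := ip_root_gt0 rsD (Da j); have gg0 := ip_root_gt0 rsD Dg.
have tt0 := ip_root_gt0 rsD Dt.
have mnorm : ip mu mu <= ip (al j) (al j).
  rewrite leNgt; apply/negP => h.
  by apply: (long_coord_neq1 rsD Dmu _ h) => //; exact: rootlet_pos.
have gnorm : ip g g <= ip (al j) (al j).
  by apply: le_trans mnorm; rewrite rootlet_norm; exact: root_long rsD _ Dg.
have ne1 : - g <> al j.
  move=> e; have /vle0P/(_ j) := g0; rewrite -[g]opprK coordN e simple_diag; lra.
have pga : pr g (al j) = -1.
  have h1 : pr (- g) (al j) <= 1.
    apply: (pairing_le1 rsD) => //; first exact: root_opp rsD _ Dg.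
    by rewrite (ipNl rsD) (ipNr rsD) opprK.
  have h2 : 1 <= pr (- g) (al j).
    apply: int_gt0_ge1; first by apply: (root_int rsD) => //; exact: root_opp rsD _ Dg.
    by rewrite (pairingNl rsD) oppr_gt0 (pairing_lt0 rsD _ (Da j)).
  by move: h1 h2; rewrite (pairingNl rsD); lra.
have Dgj : D (g + al j) by case: gjI.
(* A value of -2 or less would make 2 g + alpha_j a root, the sum of g and g + alpha_j, which both
   lie in an abelian set. *)
have pag : pr (al j) g = -1.
  have pI := root_int rsD Dg (Da j).
  have p0 : pr (al j) g < 0 by rewrite (pairing_lt0 rsD _ Dg) (ipC rsD).
  have p1 : 1 <= - pr (al j) g by apply: int_gt0_ge1; rewrite ?rpredN ?oppr_gt0.
  suff p2 : - pr (al j) g < 2.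
    have : - pr (al j) g <= 1 by apply: int_lt2_le1; rewrite ?rpredN.
    lra.
  rewrite ltNge; apply/negP => p2.
  apply: (invD_abelian ds gI gjI).
  have [p3|p3] := ltP (ip g (g + al j)) 0.
    apply: (root_add rsD) => // e.
    have /vle0P/(_ j) := g0; rewrite e coordN mxE simple_diag gj0; lra.
  have pE := pairingE rsD (al j) Dg.
  have p4 : pr (al j) g = -2.
    apply/eqP; rewrite eq_le; apply/andP; split; first lra.
    rewrite -(ler_pM2r gg0) pE; move: p3; rewrite (ipDr rsD) (ipC rsD g (al j)); lra.
  have := root_refl rsD Dg (Da j); rewrite p4 scaleNr opprK scaler_nat mulr2n.
  by rewrite addrCA addrA addrC addrCA addrA.
have eqn : ip g g = ip (al j) (al j).
  have := pairingE rsD g (Da j); have := pairingE rsD (al j) Dg.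
  by rewrite pga pag (ipC rsD g (al j)); lra.
(* By mu <= g + alpha_j, the vector g - mu has j-th coordinate -1 and nonnegative ones elsewhere, so
   its product with alpha_j is at most - |alpha_j|^2; that of g is only half of this. *)
have maj : 0 < ip mu (al j).
  have gaE := pairingE rsD g (Da j); rewrite pga in gaE.
  suff : ip (g - mu) (al j) <= - ip (al j) (al j) by rewrite !ipE; lra.
  rewrite (ip_coord rsD) (bigD1 j) //= !mxE gj0 mj add0r mulN1r gerDl.
  apply: sumr_le0 => i ij; rewrite mulr_ge0_le0 //; last exact: simple_obtuse rsD _ _ ij.
  have := mle i; rewrite mxE simple_off 1?eq_sym // addr0 => mi.
  by rewrite mxE [X in _ + X]mxE subr_ge0.
have tI : invD (word s) theta.
  by apply: (invD_up ds gI Dt); exact: root_le_top rsD _ Dg.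
have [s' [ds' wt sub]] := restrict_top ds tI.
rewrite word_top in wt.
have [g' [gE Dg' g'0 dom]] := perp_image_pos ds' wt sub gI gt.
have [x [Dx xd xx /(_ j)]] := climb_to_dom rsD Dg' g'0 dom.
have maj0 : ip mu (al j) <> 0 by move=> e; move: maj; rewrite e ltxx.
move=> /(_ maj0) xj.
have g'n : ip g' g' = ip g g.
  have := word_hf s' (inV g) (inV g); rewrite gE !hf_level0 //.
have pos x0 : invD (word s') x0 -> 0 < ip x0 theta by case/sub.
have gj_le : ip (al j) (al j) <= ip g g by rewrite eqn.
have := perp_coord_bound ds' pos Dg gt gj_le.
rewrite gE acoord_inV gj0 subr0 wt acoordB acoordD acoord_inV mj.
rewrite acoord_lift /= mxE add0r mul1r => bound.
(* The contradiction: |theta|^2 g'_j is at most |g|^2 (theta_j - 1) by [bound] and at least |g|^2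
   theta_j by dominance of x. *)
have := dom_root_ge rsD j Dx xd; rewrite xx xj g'n => dombound.
have := ler_wpM2l (ltW tt0) (ler_norm (g' 0 j)); lra.
Qed.

End Rootlet.

End AffineRoots.

(** * Linear algebra and sl2 *)

Lemma linfun_linearE (K : fieldType) (U W : vectType K) (f : U -> W) :
  linear f -> forall x, linfun f x = f x.
Proof.
move=> lf x; pose F : {linear U -> W} := HB.pack f (GRing.isLinear.Build _ _ _ _ f lf).
exact: (lfunE F x).
Qed.

Section EigenProduct.
Context (K : fieldType) (g : vectType K) (f : 'End(g)) (c : nat -> K).

Fixpoint eigen_prod (k : nat) : 'End(g) :=
  if k is k'.+1 then ((f - c k' *: \1) \o eigen_prod k')%VF else \1%VF.

Lemma eigen_prodE k a v : f v = a *: v ->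
  eigen_prod k v = (\prod_(i < k) (a - c i)) *: v.
Proof.
move=> fv; elim: k => [|k IH] /=; first by rewrite big_ord0 scale1r id_lfunE.
rewrite comp_lfunE IH linearZ /= add_lfunE opp_lfunE scale_lfunE id_lfunE fv.
by rewrite -scalerBl scalerA big_ord_recr.
Qed.

(** If all were nonzero, the kernels of the partial products would grow strictly, past the dimension
    of g. *)
Lemma eigen_chain (v : nat -> g) : injective c ->
  (forall k, f (v k) = c k *: v k) -> exists2 k, (k <= \dim {:g})%N & v k = 0.
Proof.
move=> cI fv; apply: contrapT => no.
have vn0 k : (k <= \dim {:g})%N -> v k != 0.
  by move=> kd; apply/eqP => v0; apply: no; exists k.
have dimk k : (k <= (\dim {:g}).+1)%N -> (k <= \dim (lker (eigen_prod k)))%N.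
  elim: k => // k IH kd; apply: leq_ltn_trans (IH (ltnW kd)) _.
  have sub : (lker (eigen_prod k) <= lker (eigen_prod k.+1))%VS.
    by apply/subvP => x; rewrite !memv_ker /= comp_lfunE => /eqP ->; rewrite linear0.
  have [le eqd] := dimv_leqif_sup sub.
  rewrite ltn_neqAle le andbT eqd; apply/negP => /subvP/(_ (v k)).
  rewrite !memv_ker !(eigen_prodE _ (fv k)) big_ord_recr /= subrr mulr0 scale0r eqxx.
  move=> /(_ isT); rewrite scaler_eq0 (negbTE (vn0 _ kd)) orbF => /eqP.
  move/eqP; rewrite prodf_seq_eq0 => /hasP[i _ /=]; rewrite subr_eq0 => /eqP/cI ki.
  by have := ltn_ord i; rewrite -ki ltnn.
have := leq_trans (dimk _ (leqnn _)) (dimvS (subvf _)); by rewrite ltnn.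
Qed.

End EigenProduct.

Section Lie.
Context (K : numFieldType) (g : vectType K) (br : g -> g -> g).
Hypothesis lie : lie_bracket br.

Lemma brDl x y z : br (x + y) z = br x z + br y z.
Proof. by case: lie => h _ _ _; rewrite -[x]scale1r h !scale1r. Qed.

Lemma brDr x y z : br z (x + y) = br z x + br z y.
Proof. by case: lie => _ h _ _; rewrite -[x]scale1r h !scale1r. Qed.

Lemma br0l z : br 0 z = 0.
Proof. by apply: (addrI (br 0 z)); rewrite -brDl !addr0. Qed.

Lemma br0r z : br z 0 = 0.
Proof. by apply: (addrI (br z 0)); rewrite -brDr !addr0. Qed.

Lemma brZl c x z : br (c *: x) z = c *: br x z.
Proof. by case: lie => h _ _ _; rewrite -[c *: x]addr0 h br0l addr0. Qed.

Lemma brZr c x z : br z (c *: x) = c *: br z x.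
Proof. by case: lie => _ h _ _; rewrite -[c *: x]addr0 h br0r addr0. Qed.

Lemma brNr x z : br z (- x) = - br z x.
Proof. by rewrite -scaleN1r brZr scaleN1r. Qed.

Lemma brC x y : br x y = - br y x.
Proof.
case: lie => _ _ alt _; apply/eqP; rewrite -addr_eq0; apply/eqP.
by have := alt (x + y); rewrite brDl !brDr !alt addr0 add0r.
Qed.

Lemma br_jacobi x y z : br x (br y z) = br (br x y) z + br y (br x z).
Proof.
case: lie => _ _ _ jac; have := jac x y z.
rewrite (brC z (br x y)) (brC z x) brNr => /eqP; rewrite subr_eq0 subr_eq.
by rewrite eq_sym => /eqP <-; rewrite addrC.
Qed.

Definition ad (x : g) : 'End(g) := linfun (br x).

Lemma adE x y : ad x y = br x y.
Proof. by apply: linfun_linearE => c a b; rewrite brDr brZr. Qed.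

Lemma ad_linear : linear ad.
Proof.
move=> c x y; apply/lfunP => z.
by rewrite add_lfunE scale_lfunE !adE brDl brZl.
Qed.

Lemma ad_br x y : ad (br x y) = ((ad x \o ad y) - (ad y \o ad x))%VF.
Proof.
apply/lfunP => z; rewrite add_lfunE opp_lfunE !comp_lfunE !adE.
by rewrite br_jacobi addrK.
Qed.

Definition ad_nilpotent (x : g) := exists N, forall v, iter N (br x) v = 0.

Lemma iter_br_add0 x N m v : iter N (br x) v = 0 -> iter (m + N) (br x) v = 0.
Proof. by move=> e; elim: m => //= m ->; rewrite br0r. Qed.

(* For a = 2 this is the representation theory of sl2; the case a = 0 shows
   that a bracket commuting with both its factors has only the eigenvalue 0. *)
Lemma sl2_highest (a c : K) e f h v : br e f = h -> br h f = - a *: f ->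
  v <> 0 -> br e v = 0 -> br h v = c *: v -> ad_nilpotent f ->
  exists m : nat, c = a * m%:R / 2 /\ forall j, (j <= m)%N -> iter j (br f) v <> 0.
Proof.
move=> ef hf v0 ev hv [N fN].
have hfk k : br h (iter k (br f) v) = (c - a * k%:R) *: iter k (br f) v.
  elim: k => [|k IH] /=; first by rewrite mulr0 subr0.
  rewrite br_jacobi hf brZl IH brZr -scalerDl; congr (_ *: _).
  by rewrite -natr1; ring.
have efk k : br e (iter k.+1 (br f) v) =
    (k.+1%:R * (c - a * k%:R / 2)) *: iter k (br f) v.
  elim: k => [|k IH].
    by rewrite /= br_jacobi ef hv ev br0r addr0 mulr0 mul0r subr0 mul1r.
  rewrite iterS br_jacobi ef hfk IH brZr -iterS -scalerDl; congr (_ *: _).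
  by rewrite -(natr1 k.+1) -(natr1 k); field.
have [n0 /eqP fn0 min] := ex_minnP (ex_intro (fun n => iter n (br f) v == 0) N (introT eqP (fN v))).
case: n0 => [|m] in fn0 min; first by case: v0.
have nz j : (j <= m)%N -> iter j (br f) v <> 0.
  by move=> jm /eqP/min; rewrite leqNgt ltnS jm.
exists m; split=> //.
have := efk m; rewrite fn0 br0r => /esym/eqP; rewrite scaler_eq0.
rewrite (introF eqP (nz m (leqnn m))) orbF mulf_eq0 pnatr_eq0 /= subr_eq0.
by move/eqP.
Qed.

Lemma highest_vector e h a c v : br h e = a *: e -> v <> 0 -> br h v = c *: v ->
  ad_nilpotent e -> exists k, [/\ iter k (br e) v <> 0, br e (iter k (br e) v) = 0
    & br h (iter k (br e) v) = (c + a * k%:R) *: iter k (br e) v].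
Proof.
move=> he v0 hv [N eN].
have hek k : br h (iter k (br e) v) = (c + a * k%:R) *: iter k (br e) v.
  elim: k => [|k IH] /=; first by rewrite mulr0 addr0.
  rewrite br_jacobi he brZl IH brZr -scalerDl; congr (_ *: _).
  by rewrite -natr1; ring.
have [n0 /eqP en0 min] := ex_minnP (ex_intro (fun n => iter n (br e) v == 0) N (introT eqP (eN v))).
case: n0 => [|k] in en0 min; first by case: v0.
by exists k; split=> // /eqP/min; rewrite ltnn.
Qed.

Section WeightVectors.
Context (t : {vspace g}).
Local Notation wv := (@weight_vector K g br t).

Lemma wv_br l m x y : wv l x -> wv m y -> wv (l + m) (br x y).
Proof.
move=> hx hy h; rewrite br_jacobi hx hy brZl brZr add_lfunE -scalerDl //.
Qed.

Lemma wv_iter l m x y k : wv l x -> wv m y -> wv (m + l *+ k) (iter k (br x) y).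
Proof.
move=> hx hy; elim: k => [|k IH] /=; first by rewrite mulr0n addr0.
by rewrite mulrS addrCA; exact: wv_br.
Qed.

Lemma lfun_neq0 (l : 'Hom(subvs_of t, K^o)) : l <> 0 -> exists h, l h <> 0.
Proof.
move=> l0; apply: contrapT => /forallNP no; apply: l0; apply/lfunP => h.
by rewrite zero_lfunE; apply: contrapT; exact: no.
Qed.

(** For l(h) nonzero the iterates satisfy the eigenvector equation of ad h at the distinct values
    m(h) + k l(h), so [eigen_chain] stops them. *)
Lemma wv_nil l m x v : l <> 0 -> wv l x -> wv m v -> iter (\dim {:g}) (br x) v = 0.
Proof.
move=> /lfun_neq0[h lh] hx hv.
have [|k|k kd e] := @eigen_chain _ _ (ad (vsval h)) (fun k => m h + l h * k%:R : K)
    (fun k => iter k (br x) v).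
- by move=> i j /addrI/mulfI; rewrite (introF eqP lh) => /(_ isT) /eqP; rewrite eqr_nat => /eqP.
- rewrite adE (wv_iter k hx hv h); congr (_ *: _).
  by rewrite add_lfunE; elim: k => [|k IH]; rewrite ?mulr0 ?mulr0n ?zero_lfunE //;
   rewrite mulrSr -natr1 add_lfunE addrA IH; ring.
by rewrite -(subnK kd); exact: iter_br_add0.
Qed.

End WeightVectors.
End Lie.

(** * Roots of a simple Lie algebra *)

Section LieRoots.
Context (R : realType) (g : vectType R[i]) (br : g -> g -> g).
Context (t u um : {vspace g}) (n : nat).
Context (alpha : 'I_n -> 'Hom(subvs_of t, R[i]^o)) (theta : 'rV[R]_n).
Hypotheses (lie : lie_bracket br) (simp : lie_simple br).
Hypotheses (base : root_base br alpha) (tri : triangular_decomposition br alpha u um).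
Hypothesis high : highest_root br alpha theta.

Local Notation C := (R[i]).
Local Notation T := (subvs_of t).
Local Notation V := 'rV[R]_n.
Local Notation wtv := (@wt R g t n alpha).
Local Notation wv := (@weight_vector C g br t).
Local Notation D := (Delta br alpha).
Local Notation ad := (ad br).

Lemma wtE x h : wtv x h = \sum_i (x 0 i)%:C%C * alpha i h.
Proof. by rewrite /wt sum_lfunE; apply: eq_bigr => i _; rewrite scale_lfunE. Qed.

Lemma wtD x y : wtv (x + y) = wtv x + wtv y.
Proof.
by rewrite /wt -big_split; apply: eq_bigr => i _; rewrite mxE rmorphD scalerDl.
Qed.

Lemma wtZ c x : wtv (c *: x) = c%:C%C *: wtv x.
Proof.
by rewrite /wt scaler_sumr; apply: eq_bigr => i _; rewrite mxE rmorphM scalerA.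
Qed.

Lemma wtN x : wtv (- x) = - wtv x.
Proof. by rewrite -scaleN1r wtZ rmorphN1 scaleN1r. Qed.

Lemma wt_simple i : wtv (simple_root R i) = alpha i.
Proof.
rewrite /wt (bigD1 i) //= big1 => [|j ji]; first by rewrite mxE !eqxx scale1r addr0.
by rewrite mxE eqxx (negbTE ji) scale0r.
Qed.

Lemma alpha_indep (c : 'I_n -> C) : \sum_i c i *: alpha i = 0 -> forall i, c i = 0.
Proof.
have [fr _ _] := base => e i.
have sz : size [seq alpha i | i <- enum 'I_n] == n by rewrite size_map size_enum_ord.
have /freeP/(_ c) : free (Tuple sz) by [].
apply; rewrite -[RHS]e; apply: eq_bigr => j _; congr (_ *: _).
by rewrite /= (nth_map j) ?size_enum_ord // nth_ord_enum.
Qed.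

Lemma wt_eq0 x : wtv x = 0 -> x = 0.
Proof.
move=> /alpha_indep e; apply/rowP => i; rewrite mxE.
by have [] := e i.
Qed.

Lemma wt_inj x y : wtv x = wtv y -> x = y.
Proof.
move=> e; apply/eqP; rewrite -subr_eq0; apply/eqP/wt_eq0.
by rewrite wtD wtN e subrr.
Qed.

Lemma Delta_sign x : D x -> root_le 0 x \/ root_le 0 (- x).
Proof. by have [_ _ h] := base => /h[y [/wt_inj -> ]]. Qed.

Lemma Delta_neq0 x : D x -> x <> 0.
Proof.
move=> [x0 _] e; apply: x0; rewrite e /wt big1 // => i _.
by rewrite mxE scale0r.
Qed.

Lemma Delta_simple i : D (simple_root R i).
Proof. by rewrite /Delta /= wt_simple; have [_] := base. Qed.

Lemma wv_t x : x \in t -> wv 0 x.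
Proof.
have [[[ab _] _] _ _ _ _] := tri => xt h.
by rewrite zero_lfunE scale0r ab // subvsP.
Qed.

(** The form in which the triangular decomposition is used: a linear condition holds on g once it
    holds on weight vectors. *)
Lemma weight_span (W : {vspace g}) : (forall l x, wv l x -> x \in W) -> W = fullv.
Proof.
have [_ [_ uS] [_ umS] full _] := tri => h; apply/eqP.
rewrite eqEsubv subvf -full !subv_add.
rewrite uS; last by move=> x [y _ /h].
rewrite umS; last by move=> x [y _ /h].
by rewrite andbT /=; apply/subvP => x /wv_t/h.
Qed.

Lemma decomp x : exists a b c, [/\ a \in u, b \in t, c \in um & x = a + b + c].
Proof.
have [_ _ _ full _] := tri.
have : x \in (u + t + um)%VS by rewrite full memvf.
move=> /memv_addP[y /memv_addP[a au [b bt ->]] [c cum ->]].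
by exists a, b, c.
Qed.

Lemma decomp0 a b c : a \in u -> b \in t -> c \in um -> a + b + c = 0 ->
  [/\ a = 0, b = 0 & c = 0].
Proof.
have [_ _ _ _] := tri; rewrite directv_addE /= => /and3P[d1 _ /eqP d2] au bt cum e.
have c0 : c = 0.
  apply/eqP; rewrite -memv0 -d2 memv_cap cum andbT.
  move/eqP: e; rewrite addr_eq0 => /eqP/(congr1 -%R); rewrite opprK => <-.
  by rewrite memvN memv_add.
move: d1; rewrite directv_addE /= => /and3P[_ _ /eqP d1].
move: e; rewrite c0 addr0 => e.
have b0 : b = 0.
  apply/eqP; rewrite -memv0 -d1 memv_cap bt andbT.
  by move/eqP: e; rewrite addrC addr_eq0 => /eqP ->; rewrite memvN.
by move: e; rewrite b0 addr0.
Qed.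

Lemma br_t_u h a : h \in t -> a \in u -> br h a \in u.
Proof.
have [_ [uG uS] _ _ _] := tri => ht.
suff /subvP h' : (u <= ad h @^-1: u)%VS by move=> /h'; rewrite -memv_preim adE.
apply: uS => e [x Dx xe]; rewrite -memv_preim adE // -(vsprojK ht) xe.
by apply/memvZ/uG; exists x.
Qed.

Lemma br_t_um h a : h \in t -> a \in um -> br h a \in um.
Proof.
have [_ _ [uG uS] _ _] := tri => ht.
suff /subvP h' : (um <= ad h @^-1: um)%VS by move=> /h'; rewrite -memv_preim adE.
apply: uS => e [x Dx xe]; rewrite -memv_preim adE // -(vsprojK ht) xe.
by apply/memvZ/uG; exists x.
Qed.

Lemma br_t_t h a : h \in t -> a \in t -> br h a = 0.
Proof. by have [[[ab _] _] _ _ _ _] := tri; exact: ab. Qed.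

Lemma wv_neq0_sum l x : l <> 0 -> wv l x -> x \in (u + um)%VS.
Proof.
move=> /lfun_neq0[h lh] hx.
have [a [b [c [au bt cum xE]]]] := decomp x.
have := hx h; rewrite {1}xE !brDr // (br_t_t _ bt) ?subvsP // addr0 => e.
have : l h *: x \in (u + um)%VS.
  by rewrite -e memv_add // ?br_t_u ?br_t_um ?subvsP.
by move=> /(memvZ (l h)^-1); rewrite scalerA mulVf ?scale1r //; apply/eqP.
Qed.

(** Independence of the alpha_i gives their matrix of values on a basis of t full rank. A root takes
    its height as value at this h, which separates it from 0. *)
Lemma regular_element : exists h : T, forall i, alpha i h = 1.
Proof.
pose d := \dim {:T}; pose b := vbasis {:T}.
pose B : 'M[C]_(d, n) := \matrix_(k, i) alpha i (b`_k).
have Bfull : row_free B^T.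
  rewrite -kermx_eq0; apply/eqP/row_matrixP => r; rewrite row0.
  have /sub_kermxP : (row r (kermx B^T) <= kermx B^T)%MS by exact: row_sub.
  set v := row _ _ => vB.
  suff /alpha_indep v0 : \sum_i v 0 i *: alpha i = 0.
    by apply/rowP => i; rewrite v0 mxE.
  apply/lfunP => h; rewrite zero_lfunE sum_lfunE.
  have -> : h = \sum_k coord b k h *: b`_k by apply: coord_vbasis; rewrite memvf.
  under eq_bigr do rewrite scale_lfunE linear_sum /= scaler_sumr.
  rewrite exchange_big big1 // => k _.
  have /rowP/(_ k) := vB; rewrite !mxE => vk.
  under eq_bigr do rewrite linearZ /= -[_ *: (_ *: _)]/(_ * (_ * _)) mulrCA.
  rewrite -mulr_sumr (_ : \sum_i _ = 0) ?mulr0 // -[RHS]vk.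
  by apply: eq_bigr => i _; rewrite !mxE.
have /row_fullP[A AB] : row_full B by rewrite /row_full -mxrank_tr.
pose r : 'rV[C]_d := const_mx 1 *m A.
exists (\sum_k r 0 k *: b`_k) => i.
have /matrixP/(_ 0 i) : r *m B = const_mx 1 by rewrite /r -mulmxA AB mulmx1.
rewrite !mxE linear_sum => <-; apply: eq_bigr => k _.
by rewrite linearZ /= [B _ _]mxE.
Qed.

Lemma ht_pos x : Delta_pos br alpha x ->
  exists2 m : nat, ht x = m.+1%:R & (m.+1%:R : R) <= ht theta.
Proof.
move=> [Dx x0]; have hx : ht x \is a Num.nat.
  by apply: rpred_sum => i _; have := x0 i; rewrite subr0.
have hle : ht x <= ht theta.
  apply: ler_sum => i _; have [_ /(_ x (conj Dx x0) i)] := high.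
  by rewrite !mxE => /natr_ge0; rewrite subr_ge0.
case/natrP: hx => -[|m] hm; last by exists m; rewrite -?hm.
case: (Delta_neq0 Dx); apply/rowP => i; rewrite mxE.
move/eqP: hm; rewrite psumr_eq0 => [/allP/(_ i (mem_index_enum _))/eqP //|j _].
by have := x0 j; rewrite subr0 => /natr_ge0.
Qed.

Lemma wt_regular (h : T) x : (forall i, alpha i h = 1) -> wtv x h = (ht x)%:C%C.
Proof.
by move=> h1; rewrite wtE rmorph_sum; apply: eq_bigr => i _; rewrite h1 mulr1.
Qed.

(* The product of the (ad h - k), for k = 1, ..., M, kills u but acts invertibly
   on vectors commuting with h. *)
Lemma positive_part0 (W : {vspace g}) (f : 'End(g)) (P : g -> Prop) a :
  spanned_by W P ->
  (forall e, P e -> exists2 x, Delta_pos br alpha x & f e = (ht x)%:C%C *: e) ->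
  a \in W -> f a = 0 -> a = 0.
Proof.
move=> [_ WS] fP aW fa; pose M := Num.bound (ht theta).
have /subvP/(_ a aW) : (W <= lker (eigen_prod f (fun k => k.+1%:R) M))%VS.
  apply: WS => e /fP[x Dx fe]; rewrite memv_ker (eigen_prodE _ _ fe).
  have [m mE mM] := ht_pos Dx.
  have mltM : (m < M)%N.
    have := le_lt_trans mM (archi_boundP (le_trans (ler0n _ _) mM)).
    by rewrite ltr_nat; apply: leq_trans.
  rewrite (bigD1 (Ordinal mltM)) //= mE rmorph_nat subrr mul0r scale0r //.
have fa0 : f a = 0 *: a by rewrite scale0r.
rewrite memv_ker (eigen_prodE _ _ fa0) scaler_eq0 => /orP[|/eqP //].
rewrite prodf_seq_eq0 => /hasP[i _ /=].
by rewrite sub0r oppr_eq0 pnatr_eq0.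
Qed.

(** The components of x in u and u^- are killed by ad h for a regular h, whose eigenvalues there
    are, up to sign, heights of positive roots. *)
Lemma wv0_t x : wv 0 x -> x \in t.
Proof.
have [_ uS umS _ _] := tri; have [h h1] := regular_element => x0.
have [a [b [c [au bt cum xE]]]] := decomp x.
have := x0 h; rewrite zero_lfunE scale0r {1}xE !brDr // (br_t_t _ bt) ?subvsP // => e.
have [ha _ hc] := decomp0 (br_t_u (subvsP h) au) (mem0v t) (br_t_um (subvsP h) cum) e.
have a0 : a = 0.
  apply: (@positive_part0 _ (ad (vsval h)) _ a uS) => //; last by rewrite adE.
  by move=> y [z Dz yz]; exists z; rewrite // adE // yz wt_regular.
have c0 : c = 0.
  apply: (@positive_part0 _ (- ad (vsval h)) _ c umS) => //; last first.
    by rewrite opp_lfunE adE // hc oppr0.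
  move=> y [z Dz yz]; exists z; rewrite // opp_lfunE adE // yz wtN opp_lfunE.
  by rewrite wt_regular // scaleNr opprK.
by rewrite xE a0 c0 add0r addr0.
Qed.

(** The centre is an ideal, and it is not g because some bracket is nonzero. *)
Lemma center0 x : (forall y, br x y = 0) -> x = 0.
Proof.
move=> xc; pose Z := lker (linfun ad).
have ZP z : (z \in Z) = (ad z == 0).
  by rewrite memv_ker (linfun_linearE (ad_linear lie)).
have idZ : lie_ideal br Z.
  move=> y z; rewrite !ZP => /eqP z0; rewrite ad_br // z0.
  by rewrite comp_lfun0l comp_lfun0r subrr.
have [[a [b ab]] /(_ Z idZ)[Z0|Zf]] := simp.
  apply/eqP; rewrite -memv0 -Z0 ZP; apply/eqP/lfunP => y.
  by rewrite adE // zero_lfunE.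
case: ab; rewrite -adE //.
by have := memvf a; rewrite -Zf ZP => /eqP ->; rewrite zero_lfunE.
Qed.

Lemma wv_ad_nilpotent l x : l <> 0 -> wv l x -> ad_nilpotent br x.
Proof.
move=> l0 hx; pose f := iter (\dim {:g}) (fun F : 'End(g) => (ad x \o F)%VF) \1%VF.
have fE k v : iter k (fun F : 'End(g) => (ad x \o F)%VF) \1%VF v = iter k (br x) v.
  by elim: k => [|k IH]; rewrite /= ?id_lfunE // comp_lfunE adE // IH.
exists (\dim {:g}) => v; apply/eqP; rewrite -fE -memv_ker.
suff -> : lker f = fullv by rewrite memvf.
by apply: weight_span => m y hy; rewrite memv_ker fE (wv_nil lie l0 hx hy).
Qed.

Lemma wv_opp_br l e f : wv l e -> wv (- l) f -> br e f \in t.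
Proof. by move=> he hf; apply: wv0_t; rewrite -(subrr l); exact: wv_br. Qed.

(* If l ([e, f]) = 0, then [e, f] commutes with e and f, so the diagonalizable map
   ad [e, f] has only the eigenvalue 0 and [e, f] is central. *)
Lemma wv_bracket_nonsing l e f : l <> 0 -> wv l e -> wv (- l) f ->
  br e f <> 0 -> l (vsproj t (br e f)) <> 0.
Proof.
move=> l0 he hf ef lh0; have ht0 := wv_opp_br he hf; apply: ef.
set h := br e f in lh0 ht0 *; have hv : vsval (vsproj t h) = h := vsprojK ht0.
have nl0 : - l <> 0 by move/eqP; rewrite oppr_eq0 => /eqP.
have hee : br h e = 0 *: e by rewrite -hv he lh0.
have hff : br h f = - 0 *: f by rewrite -hv hf opp_lfunE lh0.
apply: center0 => y; rewrite -adE //.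
have [[[_ dg] _] _ _ _ _] := tri; have [b [bb bdiag]] := dg _ ht0.
suff -> : ad h = 0 by rewrite zero_lfunE.
apply/(fullv_lfunP _ _ (span_basis bb)).
move=> v vb; rewrite zero_lfunE adE //; have [c hvc] := bdiag _ vb.
have v0 : v <> 0 by apply/eqP; exact: basis_not0 bb vb.
have [k [w0 ew hw]] := highest_vector lie hee v0 hvc (wv_ad_nilpotent l0 he).
have [m [cE _]] := sl2_highest lie (erefl h) hff w0 ew hw (wv_ad_nilpotent nl0 hf).
by move: cE; rewrite !mul0r addr0 => c0; rewrite hvc c0 scale0r.
Qed.

(** Otherwise u + u^- would be an ideal. If it is 0, then g = t is abelian; if it is g, then t = 0,
    so there are no roots and g = 0. *)
Lemma no_trivial_brackets : exists l e f,
  [/\ l <> 0, wv l e, wv (- l) f & br e f <> 0].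
Proof.
apply: contrapT => no.
have br0 l e f : l <> 0 -> wv l e -> wv (- l) f -> br e f = 0.
  by move=> l0 he hf; apply: contrapT => ef; apply: no; exists l, e, f.
have [_ [uG uS] [umG umS] full _] := tri; have [[a [b ab]] dich] := simp.
pose J := (u + um)%VS.
have gen l m x y : wv l x -> m <> 0 -> wv m y -> br x y \in J.
  move=> hx m0 hy; have [lm|lm] := pselect (l + m = 0).
    rewrite brC // (br0 m) ?oppr0 ?mem0v //; rewrite -(addr0_eq lm).
    by rewrite opprK.
  by apply: wv_neq0_sum lm _; exact: wv_br.
have wt_nz x : Delta_pos br alpha x -> wtv x <> 0.
  by move=> [Dx _] /wt_eq0; exact: Delta_neq0.
have gen' m x y : m <> 0 -> wv m y -> br x y \in J.
  move=> m0 hy; have adr : linear (br^~ y).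
    by move=> c x1 x2; rewrite brDl // brZl.
  have : x \in (linfun (br^~ y) @^-1: J)%VS.
    rewrite (_ : (_ @^-1: _)%VS = fullv) ?memvf //; apply: weight_span => l z hz.
    by rewrite -memv_preim (linfun_linearE adr); exact: gen hz m0 hy.
  by rewrite -memv_preim (linfun_linearE adr).
have idJ : lie_ideal br J.
  move=> x y yJ; suff /subvP/(_ y yJ) : (J <= ad x @^-1: J)%VS.
    by rewrite -memv_preim adE.
  rewrite subv_add; apply/andP; split; [apply: uS|apply: umS] => e [z Dz ze];
    rewrite -memv_preim adE //; apply: gen' ze; first exact: wt_nz.
  by rewrite wtN => /eqP; rewrite oppr_eq0 => /eqP; exact: wt_nz.
have tcase (s : g) : (forall x, x \in (u + um)%VS -> x = 0) -> s \in t.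
  move=> h; have [a' [b' [c' [au bt cum ->]]]] := decomp s.
  have -> : a' = 0 by apply: h; exact: (subvP (addvSl u um)) au.
  have -> : c' = 0 by apply: h; exact: (subvP (addvSr u um)) cum.
  by rewrite add0r addr0.
case: (dich J idJ) => [J0|Jf].
  have z x : x \in J -> x = 0 by rewrite J0 memv0 => /eqP.
  by apply: ab; apply: br_t_t; exact: tcase.
have t0 s : s \in t -> s = 0.
  move=> st; have : s \in J by rewrite Jf memvf.
  move=> /memv_addP[a' au [c' cum sE]].
  have nst : - s \in t by rewrite memvN.
  have [|_ /eqP] := decomp0 au nst cum; first by rewrite addrAC -sE subrr.
  by rewrite oppr_eq0 => /eqP.
have l0 (l : 'Hom(T, C^o)) : l = 0.
  apply/lfunP => h; rewrite zero_lfunE.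
  have -> : h = 0 by apply: subvs_inj; rewrite (t0 _ (subvsP h)) linear0.
  exact: linear0.
have noD x : Delta_pos br alpha x -> False by move=> /wt_nz; apply; exact: l0.
have u0 : (u <= 0)%VS by apply: uS => e [x /noD].
have um0 : (um <= 0)%VS by apply: umS => e [x /noD].
have Jz x : x \in J -> x = 0.
  have : (J <= 0)%VS by rewrite subv_add u0.
  by move=> /subvP h /h; rewrite memv0 => /eqP.
by apply: ab; apply: br_t_t; exact: tcase.
Qed.

Lemma sl2_triple l e f : l <> 0 -> wv l e -> wv (- l) f -> br e f <> 0 ->
  exists (h : T) e', [/\ l h = 2, wv l e' & br e' f = vsval h].
Proof.
move=> l0 he hf ef; have lh := wv_bracket_nonsing l0 he hf ef.
set h := vsproj t (br e f) in lh; set a : C := l h in lh.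
have a0 : a != 0 by apply/eqP.
exists ((2 / a) *: h), ((2 / a) *: e); split.
- by have -> : l ((2 / a) *: h) = 2 / a * a; [rewrite linearZ | rewrite divfK].
- by move=> h'; rewrite brZr // he !scalerA mulrC.
- by rewrite brZl // linearZ /= vsprojK //; exact: wv_opp_br he hf.
Qed.

(** Raising v by e ends at a highest vector with eigenvalue c + 2 k, a natural number by sl2 theory.
    The nonzero f-string is recorded because it contains the vector of reflected weight. *)
Lemma coroot_eigen_int (l : 'Hom(T, C^o)) e f (h : T) v c : l h = 2 -> l <> 0 -> wv l e ->
  wv (- l) f -> br e f = vsval h -> v <> 0 -> br (vsval h) v = c *: v ->
  exists k m : nat, [/\ c + 2 * k%:R = m%:R &
    forall j, (j <= m)%N -> iter j (br f) (iter k (br e) v) <> 0].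
Proof.
move=> lh l0 he hf ef v0 hv.
have nl0 : - l <> 0 by move/eqP; rewrite oppr_eq0 => /eqP.
have hee : br (vsval h) e = (2 : C) *: e by rewrite he lh.
have hff : br (vsval h) f = - (2 : C) *: f by rewrite hf opp_lfunE lh.
have [k [w0 ew hw]] := highest_vector lie hee v0 hv (wv_ad_nilpotent l0 he).
have [m [cE nz]] := sl2_highest lie ef hff w0 ew hw (wv_ad_nilpotent nl0 hf).
by exists k, m; split=> //; rewrite cE mulrAC mulfV ?mul1r // pnatr_eq0.
Qed.

End LieRoots.

(** * The trace form of the adjoint representation *)

Import passmx.

Section TraceForm.
Context (K : numFieldType) (g : vectType K) (br : g -> g -> g).
Context (b : (\dim {:g}).-tuple g).
Hypotheses (lie : lie_bracket br) (bb : basis_of {:g} b).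

Local Notation mx := (mxof b b).

(** The Killing form. The basis [b] is a parameter so that it can be chosen to diagonalise a given
    ad h. *)
Definition trace_form x y := \tr (mx (ad br x \o ad br y)%VF).

Lemma trace_form_linearl y : linear (trace_form^~ y : g -> K^o).
Proof.
move=> c x1 x2; rewrite /trace_form (ad_linear lie) comp_lfunDl -comp_lfunZl.
by rewrite !linearP.
Qed.

Lemma trace_form_linearr x : linear (trace_form x : g -> K^o).
Proof.
move=> c y1 y2; rewrite /trace_form (ad_linear lie) comp_lfunDr -comp_lfunZr.
by rewrite !linearP.
Qed.

Lemma trace_form_br x y z : trace_form (br x y) z = trace_form x (br y z).
Proof.
rewrite /trace_form !ad_br // comp_lfunDl comp_lfunDr comp_lfunNl comp_lfunNr.
rewrite !linearB /= comp_lfunA; congr (_ - _).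
rewrite -comp_lfunA (mxof_comp b b bb) mxtrace_mulC -(mxof_comp b b bb).
by rewrite comp_lfunA.
Qed.

(** The value at h is the sum of the squares of the eigenvalues; as these are integers, a zero sum
    kills each of them. *)
Lemma trace_form_diag h : (forall i : 'I_(\dim {:g}), exists z : int, br h b`_i = z%:~R *: b`_i) ->
  trace_form h h = 0 -> forall y, br h y = 0.
Proof.
move=> hd; have /choice[z hz] := hd.
have -> : trace_form h h = (\sum_i z i ^+ 2)%:~R.
  rewrite rmorph_sum /trace_form /mxtrace; apply: eq_bigr => i _ /=.
  rewrite !mxE /= vecof_delta comp_lfunE !adE // hz.
  rewrite (brZr lie) hz scalerA linearZ /= coord_free ?(basis_free bb) //.
  by rewrite eqxx mulr1 rmorphXn expr2.
move=> /eqP; rewrite intr_eq0 psumr_eq0 => [/allP z0 y|i _]; last exact: sqr_ge0.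
have hz0 (i : 'I_(\dim {:g})) : br h b`_i = 0.
  have := z0 i (mem_index_enum _); rewrite /= sqrf_eq0 => /eqP zi.
  by rewrite hz zi scale0r.
rewrite -adE // (coord_basis bb (memvf y)) linear_sum big1 // => i _.
by rewrite linearZ /= adE // hz0 scaler0.
Qed.

End TraceForm.

(** * Existence and integrality of coroots *)

Section RootSystemOfLie.
Context (R : realType) (g : vectType R[i]) (br : g -> g -> g).
Context (t u um : {vspace g}) (n : nat).
Context (alpha : 'I_n -> 'Hom(subvs_of t, R[i]^o)) (theta : 'rV[R]_n).
Hypotheses (lie : lie_bracket br) (simp : lie_simple br).
Hypotheses (base : root_base br alpha) (tri : triangular_decomposition br alpha u um).
Hypothesis high : highest_root br alpha theta.

Local Notation C := (R[i]).
Local Notation T := (subvs_of t).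
Local Notation V := 'rV[R]_n.
Local Notation wtv := (@wt R g t n alpha).
Local Notation wv := (@weight_vector C g br t).
Local Notation D := (Delta br alpha).
Local Notation ad := (ad br).

Lemma eigen_int (l : 'Hom(T, C^o)) e f (h : T) v c : l h = 2 -> l <> 0 -> wv l e ->
  wv (- l) f -> br e f = vsval h -> v <> 0 -> br (vsval h) v = c *: v ->
  exists z : int, c = z%:~R.
Proof.
move=> lh l0 he hf ef v0 hv.
have [k [m [cE _]]] := coroot_eigen_int lie tri lh l0 he hf ef v0 hv.
exists (m%:Z - 2 * k%:Z); rewrite intrB intrM -!pmulrn -cE.
by rewrite addrK.
Qed.

(** The vector is f^(k+z) e^k v with e^k v highest; the f-string stays nonzero up to exponent z + 2
    k, which is at least k + z. *)
Lemma wv_swap (l m : 'Hom(T, C^o)) e f (h : T) v (z : nat) : l h = 2 -> l <> 0 ->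
  wv l e -> wv (- l) f -> br e f = vsval h -> v <> 0 -> wv m v -> m h = z%:R ->
  exists2 v', v' <> 0 & wv (m - l *+ z) v'.
Proof.
move=> lh l0 he hf ef v0 hv mh.
have hvh : br (vsval h) v = (z%:R : C) *: v by rewrite hv mh.
have [k [m0 [cE nz]]] := coroot_eigen_int lie tri lh l0 he hf ef v0 hvh.
have kz : (k + z <= m0)%N.
  by move/eqP: cE; rewrite -natrM -natrD eqr_nat => /eqP; lia.
exists (iter (k + z) (br f) (iter k (br e) v)); first exact: nz.
have -> : m - l *+ z = m + l *+ k + (- l) *+ (k + z).
  by rewrite mulrnDr mulNrn mulNrn addrA addrK.
by apply: wv_iter => //; exact: wv_iter.
Qed.

Lemma coroot_int x y h : D x -> coroot br alpha x h -> D y ->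
  exists2 z : int, wtv y h = z%:~R & D (y - z%:~R *: x).
Proof.
move=> [x0 _] [lh [e [f [he hf ef]]]] [y0 [v [v0 hv]]].
rewrite wtN in hf.
have hvh : br (vsval h) v = wtv y h *: v by exact: hv.
have [z zE] := eigen_int lh x0 he hf ef v0 hvh.
exists z => //.
suff [v' v'0 hv'] : exists2 v', v' <> 0 & wv (wtv y - wtv x *~ z) v'.
  have wE : wtv (y - z%:~R *: x) = wtv y - wtv x *~ z.
    by rewrite wtD wtN wtZ rmorph_int scaler_int.
  split; last by rewrite wE; exists v'.
  (* The reflected weight takes the value - z at h; if it vanished, then z = 0 and it would be the
     weight of y itself. *)
  rewrite wE => w0; apply: y0.
  have := congr1 (fun F : 'Hom(T, C^o) => F h) w0.
  rewrite zero_lfunE add_lfunE opp_lfunE.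
  have -> : (wtv x *~ z) h = z%:~R * 2 by rewrite -scaler_int scale_lfunE lh.
  rewrite zE -{1}[z%:~R]mulr1 -mulrBr => /eqP; rewrite mulf_eq0 intr_eq0.
  rewrite -[1 - 2]/(1 - (1 + 1)) opprD addNKr oppr_eq0 oner_eq0 orbF => /eqP z0.
  by move: w0; rewrite z0 mulr0z subr0.
case: z zE => z zE; first exact: wv_swap lh x0 he hf ef v0 hv zE.
(* A negative z is treated with the triple f, e, - h of the opposite root. *)
have lh' : (- wtv x) (- h) = 2 by rewrite opp_lfunE linearN opprK.
have nx0 : - wtv x <> 0 by move/eqP; rewrite oppr_eq0 => /eqP.
have he' : wv (- - wtv x) e by rewrite opprK.
have ef' : br f e = vsval (- h) by rewrite brC // ef linearN.
have zE' : wtv y (- h) = z.+1%:R by rewrite linearN /= zE NegzE mulrNz opprK.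
have [v' v'0 hv'] := wv_swap lh' nx0 hf he' ef' v0 hv zE'.
by exists v' => //; move: hv'; rewrite NegzE mulrNz mulNrn.
Qed.

Lemma coroot_exists x : D x -> exists h, coroot br alpha x h.
Proof.
move=> [x0 [e [e0 he]]].
suff [f hf ef] : exists2 f, wv (- wtv x) f & br e f <> 0.
  have [h [e' [lh he' ef']]] := sl2_triple lie simp base tri high x0 he hf ef.
  by exists h; split=> //; exists e', f; split; rewrite ?wtN.
(* This triple, of some nonzero weight l, provides the h on which a vanishing trace form is
   contradicted. *)
have [l [e1 [f1 [l0 he1 hf1 ef1]]]] := no_trivial_brackets lie simp base tri.
have [h [e2 [lh he2 ef2]]] := sl2_triple lie simp base tri high l0 he1 hf1 ef1.
have [[[_ dg] _] _ _ _ _] := tri; have [b0 [bb0 bdiag]] := dg _ (subvsP h).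
have sz : size b0 == \dim {:g} by rewrite (size_basis (X := in_tuple b0) bb0).
pose b := Tuple sz; have bb : basis_of {:g} b by exact: bb0.
have bint (i : 'I_(\dim {:g})) : exists z : int, br (vsval h) b`_i = z%:~R *: b`_i.
  have bi : b`_i \in b0 by rewrite mem_nth // (eqP sz).
  have [c hc] := bdiag _ bi.
  have bi0 : b`_i <> 0 by apply/eqP; exact: basis_not0 bb0 bi.
  by have [z zE] := eigen_int lh l0 he2 hf1 ef2 bi0 hc; exists z; rewrite -zE.
pose K := trace_form br b.
have Kl y z w c : K (c *: y + z) w = c * K y w + K z w by exact: trace_form_linearl.
have Kr y z w c : K w (c *: y + z) = c * K w y + K w z by exact: trace_form_linearr.
have K0l w : K 0 w = 0 by have := Kl 0 0 w (-1); rewrite scaler0 addr0 mulN1r addNr.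
have K0r w : K w 0 = 0 by have := Kr 0 0 w (-1); rewrite scaler0 addr0 mulN1r addNr.
have KZl c y w : K (c *: y) w = c * K y w by rewrite -[c *: y]addr0 Kl K0l addr0.
have KZr c y w : K w (c *: y) = c * K w y by rewrite -[c *: y]addr0 Kr K0r addr0.
have Kbr y z w : K (br y z) w = K y (br z w) by exact: trace_form_br.
have KNl y w : K (- y) w = - K y w by rewrite -scaleN1r KZl mulN1r.
apply: contrapT => no; have brz f : wv (- wtv x) f -> br e f = 0.
  by move=> hf; apply: contrapT => ef; apply: no; exists f.
(* Invariance of the form gives this on weights m with x + m nonzero; at m = - x it follows from
   [e, z] = 0. *)
have Ke y : K e y = 0.
  have Klin : linear (K e : g -> C^o) by exact: trace_form_linearr.
  have : y \in lker (linfun (K e : g -> C^o)).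
    rewrite (_ : lker _ = fullv) ?memvf //; apply: (weight_span tri) => m z hz.
    rewrite memv_ker (linfun_linearE Klin); apply/eqP.
    have [xm|xm] := pselect (wtv x + m = 0).
      have [s xs] := lfun_neq0 x0.
      have hz' : wv (- wtv x) z by rewrite (addr0_eq xm).
      have := Kbr e z (vsval s); rewrite brz // K0l (brC lie) -scaleN1r KZr hz KZr.
      move/esym/eqP; rewrite mulN1r oppr_eq0 mulf_eq0 -(addr0_eq xm) opp_lfunE oppr_eq0.
      by move=> /orP[/eqP|/eqP].
    have [s xs] := lfun_neq0 xm.
    have := Kbr e (vsval s) z; rewrite (brC lie) he hz KNl KZl KZr => /esym/eqP.
    rewrite eq_sym -subr_eq0 -opprD -mulrDl oppr_eq0 mulf_eq0 => /orP[|/eqP //].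
    by rewrite -[_ + _]/((wtv x : T -> C) s + m s) => /eqP h0; case: xs; rewrite add_lfunE.
  by rewrite memv_ker (linfun_linearE Klin) => /eqP.
pose F := fun y : g => linfun (K y : g -> C^o) : 'Hom(g, C^o).
have FE y z : F y z = K y z by apply: linfun_linearE; exact: trace_form_linearr.
have Flin : linear F.
  move=> c y z; apply/lfunP => w; rewrite add_lfunE scale_lfunE !FE; exact: Kl.
pose Rad := lker (linfun F).
have RadP y : y \in Rad <-> forall z, K y z = 0.
  rewrite memv_ker (linfun_linearE Flin); split=> [/eqP Fy z|h0].
    by rewrite -FE Fy zero_lfunE.
  by apply/eqP/lfunP => z; rewrite FE zero_lfunE.
have idR : lie_ideal br Rad.
  by move=> y z /RadP zR; apply/RadP => w; rewrite (brC lie) KNl Kbr zR oppr0.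
have [_ /(_ Rad idR)[R0|Rf]] := simp.
  by apply: e0; apply/eqP; rewrite -memv0 -R0; apply/RadP.
have /RadP hh : vsval h \in Rad by rewrite Rf memvf.
have h0 := trace_form_diag lie bb bint (hh _).
have e20 : e2 = 0.
  have := he2 h; rewrite h0 lh => /esym/eqP; rewrite scaler_eq0 pnatr_eq0 /=.
  by move/eqP.
have hv0 : vsval h = 0 by rewrite -ef2 e20 br0l.
have : l h = 0.
  by have -> : h = 0 by [apply: subvs_inj; rewrite hv0 linear0]; rewrite linear0.
by rewrite lh => /eqP; rewrite pnatr_eq0.
Qed.

End RootSystemOfLie.

(** * From the Lie algebra to the abstract root system *)

Section Assembly.
Context (R : realType) (g : vectType R[i]) (br : g -> g -> g).
Context (t u um : {vspace g}) (n : nat).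
Context (alpha : 'I_n -> 'Hom(subvs_of t, R[i]^o)).
Context (ip : 'rV[R]_n -> 'rV[R]_n -> R) (theta : 'rV[R]_n).
Hypotheses (lie : lie_bracket br) (simp : lie_simple br).
Hypotheses (base : root_base br alpha) (tri : triangular_decomposition br alpha u um).
Hypotheses (ipP : inner_product ip) (inv : weyl_invariant br alpha ip).
Hypothesis high : highest_root br alpha theta.

Local Notation D := (Delta br alpha).
Local Notation wtv := (@wt R g t n alpha).

(** The reflection preserves the form and sends x to - x, whence (y, x) = - (y, x) + y(h) (x, x).
    Integrality of the alpha_i (h) makes y(h) real, so that the reflection is a map of V. *)
Lemma coroot_pairing x h : D x -> coroot br alpha x h ->
  forall y, wtv y h = (pairing ip y x)%:C%C.
Proof.
move=> Dx xh.
have /choice[z hz] : forall i, exists z : int, alpha i h = z%:~R.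
  move=> i; have [z zE _] := coroot_int lie tri Dx xh (Delta_simple base i).
  by exists z; rewrite -zE wt_simple.
pose c (y : 'rV[R]_n) : R := \sum_i y 0 i * (z i)%:~R.
have cE y : wtv y h = (c y)%:C%C.
  rewrite wtE /c rmorph_sum; apply: eq_bigr => i _.
  by rewrite hz rmorphM rmorph_int.
pose s y := y - c y *: x.
have sW : weyl_group br alpha (s \o id).
  apply: gen_comp; last exact: gen_id.
  by exists x, h; split=> // y; rewrite /s wtD wtN wtZ cE.
have cx : c x = 2.
  have [xh2 _] := xh; apply: (@complexI R); rewrite -cE xh2.
  by rewrite rmorph_nat.
have [lin sym pos] := ipP.
have ipD a b d : ip (a + b) d = ip a d + ip b d by have := lin 1 a b d; rewrite scale1r mul1r.
have ip0 d : ip 0 d = 0 by apply: (addrI (ip 0 d)); rewrite -ipD !addr0.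
have ipZ k a d : ip (k *: a) d = k * ip a d by rewrite -[k *: a]addr0 lin ip0 addr0.
have xx0 : 0 < ip x x by apply: pos; exact: Delta_neq0 Dx.
move=> y; rewrite cE; congr (_%:C)%C.
have := inv sW y x; rewrite /= {2}/s cx.
have -> : x - 2 *: x = -1 *: x by rewrite scaleN1r scaler_nat mulr2n opprD addNKr.
rewrite (sym _ (_ *: x)) ipZ (sym x) /s -scaleNr ipD ipZ => e.
rewrite /pairing; apply: (mulIf (lt0r_neq0 xx0)).
rewrite divfK ?lt0r_neq0 //; lra.
Qed.

Lemma lie_root_system : root_system ip D theta.
Proof.
have key x y : D x -> D y -> exists z : int,
    pairing ip y x = z%:~R /\ D (y - z%:~R *: x).
  move=> Dx Dy; have [h xh] := coroot_exists lie simp base tri high Dx.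
  have [z zE Dz] := coroot_int lie tri Dx xh Dy.
  exists z; split=> //; apply: (@complexI R).
  by rewrite -(coroot_pairing Dx xh) zE rmorph_int.
have [[Dt t0] tmax] := high; split=> //.
- by move=> x; exact: Delta_neq0.
- by move=> x y Dx Dy; have [z [-> _]] := key x y Dx Dy; exact: intr_int.
- by move=> x y Dx Dy; have [z [-> ]] := key x y Dx Dy.
- by move=> x; exact: Delta_sign.
- by move=> i; exact: Delta_simple.
- by move=> x Dx x0; exact: tmax.
Qed.

Lemma hatDelta_posE b : hatDelta_pos br alpha b <-> real_root D b /\ hpos theta b.
Proof.
have rsD := lie_root_system; split.
  case=> [[x [Dx x0] <-]|[x [k [Dx k1 ->]]]].
    split; first exact: level0_root.
    apply/level0_pos => i; have := x0 i; rewrite !mxE subr0; exact: natr_ge0.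
  have Dnx := root_opp rsD Dx.
  have -> : inV x + delta R n *+ k = delta R n *+ k - inV (- x) by rewrite inVN opprK addrC.
  by split; [exact: deltaB_root rsD _ _ Dnx|exact: (deltaB_pos rsD Dnx)].
case=> [[Db bI b2] b0].
have lev : 0 <= (b.1.2 : R) by rewrite -(acoord0 theta).
have /natrP[k kE] : (b.1.2 : R) \is a Num.nat by rewrite natrEint bI.
have kdelta : delta R n *+ k = (0, k%:R, 0).
  elim: k {kE} => [|k IH]; first by [].
  by rewrite mulrS IH; apply: hatV_eq; rewrite /= ?addr0 // mulrS.
have bE : b = inV b.1.1 + delta R n *+ k.
  by rewrite kdelta; apply: hatV_eq; rewrite /= ?addr0 ?add0r.
case: k kE kdelta bE => [|k] kE kdelta bE; last by right; exists b.1.1, k.+1.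
left; exists b.1.1; last by rewrite {2}bE mulr0n addr0.
split=> // i; rewrite subr0 natrEint (root_coord_int rsD) //=.
by have := b0 (lift ord0 i); rewrite acoord_lift kE mul0r addr0.
Qed.

Lemma minuscule_word I w : minuscule br alpha ip theta I w ->
  exists s, [/\ w = word ip theta s, delta_only D theta (word ip theta s)
              & forall x, I x -> invD D theta (word ip theta s) x].
Proof.
move=> [/affine_weyl_word[s ->] ID invE]; exists s; split=> //.
  move=> b rb b0 neg.
  have : inversions br alpha (word ip theta s) b.
    split; first by apply/hatDelta_posE.
    apply/hatDelta_posE; split=> //; apply: real_rootN lie_root_system _ _.
    exact: word_root lie_root_system _ _ rb.
  by rewrite invE => -[x /ID Dx <-]; exists x.
move=> x Ix; split; first exact: ID.
have : inversions br alpha (word ip theta s) (delta R n - inV x).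
  by rewrite invE; exists x.
by case=> _ /hatDelta_posE[].
Qed.

Lemma Ab_rootlet_upper mu : D mu -> forall I,
  Ab_rootlet br alpha ip theta u mu I ->
  ideal_roots br alpha I `<=` upper_roots br alpha mu.
Proof.
move=> Dmu I [_ _ rtI] nu nuI; have [nuD _] := nuI.
set S := ideal_roots br alpha I in rtI nuI.
have rsD := lie_root_system.
have [[w wm]|no] := pselect (exists w, minuscule br alpha ip theta S w); last first.
  (* Levels exclude the default [id]: it would give the rootlet level 2, while mu has level 0. *)
  have := congr1 (fun v : hatV R n => v.1.2 : R) rtI.
  rewrite /rootlet /minuscule_of xgetPN; last by move=> w wm; apply: no; exists w.
  rewrite /= oppr0 addr0 => /eqP.
  by rewrite -[1 + 1]/(2 : R) pnatr_eq0.
have /minuscule_word[s [wE ds sub]] :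
    minuscule br alpha ip theta S (minuscule_of br alpha ip theta S).
  exact: xgetPex (ex_intro _ w wm).
have rt : word ip theta s (delta R n *+ 2 - inV theta) = inV mu by rewrite -wE.
have le := rootlet_le rsD ds Dmu rt (sub _ nuI).
split=> // i; have [Dnu _] := nuD.
rewrite natrEint; apply/andP; split.
  by rewrite !mxE rpredB // (root_coord_int rsD).
by rewrite !mxE subr_ge0 le.
Qed.

End Assembly.

Theorem theorem3p5 (R : realType) (g : vectType R[i]) (br : g -> g -> g)
    (t u um : {vspace g}) (n : nat)
    (alpha : 'I_n -> 'Hom(subvs_of t, R[i]^o))
    (ip : 'rV[R]_n -> 'rV[R]_n -> R) (theta : 'rV[R]_n) :
  lie_bracket br -> lie_simple br ->
  root_base br alpha -> triangular_decomposition br alpha u um ->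
  inner_product ip -> weyl_invariant br alpha ip ->
  highest_root br alpha theta ->
  forall mu : 'rV[R]_n, long_pos br alpha ip mu ->
    (forall Imax : {vspace g},
       unique_maximal (Ab_rootlet br alpha ip theta u mu) Imax ->
       ideal_roots br alpha Imax `<=` upper_roots br alpha mu) /\
    (forall I : {vspace g},
       Ab_rootlet br alpha ip theta u mu I ->
       ideal_roots br alpha I `<=` upper_roots br alpha mu).
Proof.
move=> lie simp base tri ipP inv high mu [[Dmu _] _].
have upper := Ab_rootlet_upper lie simp base tri ipP inv high Dmu.
by split=> [Imax [[ab _] _]|I ab]; exact: upper ab.
Qed.
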